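(* For any non-degenerate $k$-simplex $\Delta$ in $\mathbb{R}^k$, there is a dense family of smooth embeddings $\gamma\colon S^{k-1}\hookrightarrow\mathbb{R}^k$ among the smooth embeddings that are isotopic to the standard embedding through a differentiable isotopy in $\mathbb{R}^k$ (dense in the Whitney $C^m$-topology for every $m$), such that for each $\gamma$ in the family the set of simplices in $\mathrm{Sim}(\Delta)$ inscribed in $\gamma(S^{k-1})$ contains, for each $U\in\mathrm{O}(k)$, a simplex (similar to $\Delta$) whose pose is $U$.
   Context: $C_{k+1}(\mathbb{R}^k)$ is the space of $(k+1)$-tuples $\mathbf q=(\mathbf q_0,\dots,\mathbf q_k)$ of pairwise distinct points in $\mathbb{R}^k$. For distinct indices, $\pi_{ij}(\mathbf q)=\frac{\mathbf q_i-\mathbf q_j}{|\mathbf q_i-\mathbf q_j|}$ and $r_{ijl}(\mathbf q)=\frac{|\mathbf q_i-\mathbf q_j|}{|\mathbf q_i-\mathbf q_l|}$. A non-degenerate $k$-simplex is $\Delta=(\mathbf p_0,\dots,\mathbf p_k)\in C_{k+1}(\mathbb{R}^k)$ such that no hyperplane of $\mathbb{R}^k$ contains more than $k$ of the points (equivalently, nonzero volume). $\mathrm{Sim}(\Delta)$ is the set of all $\mathbf q\in C_{k+1}(\mathbb{R}^k)$ with $r_{ijl}(\mathbf q)=r_{ijl}(\Delta)$ for all distinct $i,j,l$, i.e. the space of simplices similar to $\Delta$. Let $\Pi(\mathbf q)$ be the $k\times k$ matrix with columns $\pi_{10}(\mathbf q),\dots,\pi_{k0}(\mathbf q)$, and $P(\Delta)$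 the symmetric positive-definite square root of $\Pi(\Delta)^T\Pi(\Delta)$. The pose of $\mathbf q\in\mathrm{Sim}(\Delta)$ is the unique orthogonal matrix $U(\mathbf q)$ with $\Pi(\mathbf q)=U(\mathbf q)P(\Delta)$. A simplex $\mathbf q$ is inscribed in $\gamma(S^{k-1})$ if all its vertices $\mathbf q_i$ lie on $\gamma(S^{k-1})$. The standard embedding is the inclusion of the unit sphere. Smooth means $C^\infty$. *)

(* Defs.v *)
From HB Require Import structures.
From mathcomp Require Import all_boot all_order all_algebra.
From mathcomp Require Import all_classical all_reals all_analysis.

Set Implicit Arguments.
Unset Strict Implicit.
Unset Printing Implicit Defensive.
Import Order.TTheory GRing.Theory Num.Theory.
Import numFieldNormedType.Exports.

Local Open Scope classical_set_scope.
Local Open Scope ring_scope.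

Section Euclidean.
Context {R : realType} {k : nat}.
Implicit Types x y : 'cV[R]_k.

Definition dotp x y : R := \sum_i x i 0 * y i 0.

(* The Euclidean norm; MathComp-Analysis' [`|x|] on matrices is the sup norm
   (which induces the same topology). *)
Definition enorm x : R := Num.sqrt (dotp x x).

Definition sphere : set 'cV[R]_k := [set x | enorm x = 1].

Definition orthogonal_mx (U : 'M[R]_k) : Prop := U^T *m U = 1%:M.

End Euclidean.

Arguments sphere {R} k.

Section Smooth.
Context {R : realType}.

Fixpoint iter_derive (V W : normedModType R) (vs : seq V) (f : V -> W)
    : V -> W :=
  if vs is v :: vs' then fun x => 'D_v (iter_derive vs' f) x else f.

(* C^oo on the open set [A]: all iterated directional derivatives exist and
   are (Frechet) differentiable at every point of [A]. *)
Definition smooth_on (V W : normedModType R) (A : set V) (f : V -> W) : Prop :=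
  forall (vs : seq V) (x : V), A x -> differentiable (iter_derive vs f) x.

End Smooth.

(* A map S^(k-1) -> R^k is represented by a function on R^k of which only the
   values on the sphere are ever used. *)
Section SphereMaps.
Context {R : realType} {k : nat}.
Implicit Types f g : 'cV[R]_k -> 'cV[R]_k.

(* The extension of a map of the sphere to R^k \ {0} that is constant along
   rays, i.e. its composite with the smooth retraction x |-> x / |x|. At a point
   x of the sphere, its derivative along a vector v orthogonal to x is
   therefore the value at v of the tangent map T_x S^(k-1) -> R^k. *)
Definition radial f : 'cV[R]_k -> 'cV[R]_k := fun x => f ((enorm x)^-1 *: x).

Definition smooth_sphere_map f : Prop :=
  smooth_on [set x : 'cV[R]_k | x != 0] (radial f).

Definition immersion f : Prop :=
  forall x v : 'cV[R]_k, sphere k x -> dotp x v = 0 ->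
    'D_v (radial f) x = 0 -> v = 0.

(* The last clause: [f] is open onto its image, i.e. its inverse is continuous. *)
Definition topological_embedding f : Prop :=
  {within sphere k, continuous f} /\
  {in sphere k &, injective f} /\
  forall A : set 'cV[R]_k, open A ->
    exists B : set 'cV[R]_k,
      open B /\ f @` (sphere k `&` A) = f @` sphere k `&` B.

Definition smooth_embedding f : Prop :=
  [/\ smooth_sphere_map f, immersion f & topological_embedding f].

(* Smooth isotopy through embeddings, [F t] for t in [0, 1]. As usual,
   smoothness on S^(k-1) x [0, 1] means that the map extends smoothly to
   S^(k-1) x W for some open neighbourhood W of [0, 1]; the values of [F]
   outside [0, 1] are those of the extension. *)
Definition isotopic f g : Prop :=
  exists (W : set R) (F : R -> 'cV[R]_k -> 'cV[R]_k),
    [/\ open W, `[0, 1]%classic `<=` W,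
        smooth_on [set p : R * 'cV[R]_k | W p.1 /\ p.2 != 0]
                  (fun p : R * 'cV[R]_k => radial (F p.1) p.2),
        (forall t : R, 0 <= t <= 1 -> smooth_embedding (F t)) &
        (forall x, sphere k x -> F 0 x = f x /\ F 1 x = g x)].

Definition standard_embedding : 'cV[R]_k -> 'cV[R]_k := id.

(* [f] and [g] are [e]-close in the C^m norm: all partial derivatives of order
   at most [m] of the radial extensions differ by less than [e] on the sphere.
   As the sphere is compact, these sets of [g] form a base of neighbourhoods
   of [f] for the Whitney C^m topology (the strong and weak topologies agree). *)
Definition Cm_close (m : nat) (e : R) f g : Prop :=
  forall (s : seq 'I_k) (x : 'cV[R]_k), (size s <= m)%N -> sphere k x ->
    enorm (iter_derive [seq delta_mx i 0 | i <- s] (radial g) x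
           - iter_derive [seq delta_mx i 0 | i <- s] (radial f) x) < e.

Definition Cm_dense (m : nat) (A B : set ('cV[R]_k -> 'cV[R]_k)) : Prop :=
  A `<=` B /\
  forall f, B f -> forall e : R, 0 < e -> exists g, A g /\ Cm_close m e f g.

Definition isotopic_to_standard : set ('cV[R]_k -> 'cV[R]_k) :=
  [set f | smooth_embedding f /\ isotopic standard_embedding f].

End SphereMaps.

Section Simplices.
Context {R : realType} {k : nat}.
Implicit Types p q : 'I_k.+1 -> 'cV[R]_k.

(* [q] is a point of C_(k+1)(R^k). *)
Definition configuration q : Prop := injective q.

Definition dir q (i j : 'I_k.+1) : 'cV[R]_k :=
  (enorm (q i - q j))^-1 *: (q i - q j).

Definition ratio q (i j l : 'I_k.+1) : R :=
  enorm (q i - q j) / enorm (q i - q l).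

Definition nondegenerate_simplex p : Prop :=
  configuration p /\
  forall (a : 'cV[R]_k) (b : R), a != 0 ->
    (#|[set i : 'I_k.+1 | dotp a (p i) == b]%SET| <= k)%N.

(* Sim(p). *)
Definition similar_simplices p : set ('I_k.+1 -> 'cV[R]_k) :=
  [set q | configuration q /\
    forall i j l, i != j -> j != l -> i != l -> ratio q i j l = ratio p i j l].

Definition dir_mx q : 'M[R]_k :=
  \matrix_(i, j) dir q (lift ord0 j) ord0 i 0.

Definition positive_definite (M : 'M[R]_k) : Prop :=
  M^T = M /\ forall v : 'cV[R]_k, v != 0 -> 0 < dotp v (M *m v).

(* The symmetric positive-definite square root of dir_mx(p)^T dir_mx(p)
   (the default value 0 is not used when [p] is non-degenerate). *)
Definition gram_sqrt p : 'M[R]_k :=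
  xget 0 [set P | positive_definite P /\ P *m P = (dir_mx p)^T *m dir_mx p].

(* The pose of [q] in Sim(p), [p] non-degenerate. The default value 0 is not
   an orthogonal matrix when 0 < k. *)
Definition pose p q : 'M[R]_k :=
  xget 0 [set U | orthogonal_mx U /\ dir_mx q = U *m gram_sqrt p].

Definition inscribed q (f : 'cV[R]_k -> 'cV[R]_k) : Prop :=
  forall i, (f @` sphere k) (q i).

End Simplices.

(* Main.v *)
(* Homothets of a simplex inscribed in a hypersurface isotopic to the sphere (Gromov), by
   continuation along the isotopy [F]. Every embedding isotopic to the standard one can be put
   in the family, so density is immediate. For fixed [U] the edge vectors [v i] of the rotated
   simplex are prescribed up to a scale [s], and one looks for [x 0, ..., x k] on the sphere and
   [s > 0] with [F 1 (x i) - F 1 (x 0) = s v i]: as many equations as unknowns. In the box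
   [eps <= s <= S] no solution escapes through the boundary during the isotopy: a small solution
   would produce, in the limit, a tangent hyperplane of an embedded sphere containing all the
   [v i], and large ones are excluded because the images stay bounded. At time 0 the system
   says that the simplex is inscribed in the round sphere, and it deforms to a translation,
   [z |-> z - z0]. That the zero survives is the homotopy invariance of essential maps, which
   rests on the Poincare-Miranda theorem, which in turn follows from a discrete
   Stokes formula on a cubical grid. *)

(* The sphere conditions are made into equations, so that the unknowns fill a box in R^(k(k+1)+1),
   where boundary values alone can force a zero. The price is that the isotopy must be extended off
   the sphere and that vertices off the sphere must be allowed. The deformations at time 0 are
   controlled because, once the edges are prescribed, the differences of the squared norms of the
   vertices encode 2 s times the circumcentre: the quadratic conditions are then positive multiples
   of the affine ones, circumcentre at the origin and [s = s0]. The delicate point is the lower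
   bound [eps] on the scale. It must be uniform in the time and in the point near which a simplex
   shrinks, while nothing is known of the directions of the chords x_i - x_0 on the sphere. Hence a
   differentiability estimate in which the time and both ends of the chord move, followed by
   compactness. A pose [U] is prescribed by rotating the given simplex by U P M^-1, where M is its
   matrix of directions and P the positive root of M^T M; this product is orthogonal because P^2 =
   M^T M. *)
Require Import Defs.
From HB Require Import structures.
From mathcomp Require Import all_boot all_order all_algebra all_fingroup.
From mathcomp Require Import all_classical all_reals all_analysis.
From mathcomp Require Import ring lra.
Set Implicit Arguments.
Unset Strict Implicit.
Unset Printing Implicit Defensive.
Import Order.TTheory GRing.Theory Num.Theory.
Import numFieldNormedType.Exports.
Local Open Scope classical_set_scope.
Local Open Scope ring_scope.

(** * A discrete Stokes formula on a cubical grid *)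

Section Derivation.
Context {A : pzRingType}.
Implicit Types (t x y : A).

Definition rcomm t x : A := t * x - x * t.

Lemma rcommM t x y : rcomm t (x * y) = rcomm t x * y + x * rcomm t y.
Proof. by rewrite /rcomm mulrBl mulrBr !mulrA addrA subrK. Qed.

Let addBBAC (a b c d : A) : (a - b) + (d - c) = (a - c) + (d - b).
Proof. by rewrite addrACA [- b - c]addrC addrACA. Qed.

Lemma rcommB t x y : rcomm t (x - y) = rcomm t x - rcomm t y.
Proof. by rewrite /rcomm mulrBr mulrBl !opprB addBBAC. Qed.

Lemma rcommC t t' x : t * t' = t' * t -> rcomm t (rcomm t' x) = rcomm t' (rcomm t x).
Proof.
move=> tt'; rewrite /rcomm !mulrBr !mulrBl !mulrA tt' !opprB.
by rewrite -[x * t' * t]mulrA -tt' mulrA addBBAC.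
Qed.

Lemma rcomm_prod (I : eqType) (r : seq I) t (X : I -> A) : uniq r ->
  rcomm t (\prod_(l <- r) X l) =
  \sum_(m <- r) \prod_(l <- r) (if l == m then rcomm t (X l) else X l).
Proof.
elim: r => [|i r IHr] /=; first by rewrite !big_nil /rcomm mulr1 mul1r subrr.
case/andP=> ir ur; rewrite !big_cons rcommM IHr// eqxx; congr (_ + _).
  by congr (_ * _); apply: eq_big_seq => l lr; case: eqP => // li; rewrite -li lr in ir.
rewrite big_distrr/=; apply: eq_big_seq => m mr.
by rewrite big_cons; case: eqP => // im; rewrite im mr in ir.
Qed.

End Derivation.

(** Additivity of a noncommutative product in its slot [m]; it compares two families of labels that
    differ in one component. *)
Lemma prod_slotB (A : pzRingType) (I : eqType) (r : seq I) (m : I) (X Y Z : I -> A) :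
    uniq r -> m \in r -> X m = Y m - Z m ->
    (forall l, l != m -> X l = Y l) -> (forall l, l != m -> X l = Z l) ->
  \prod_(l <- r) X l = \prod_(l <- r) Y l - \prod_(l <- r) Z l.
Proof.
move=> + + Xm XY XZ; elim: r => //= i r IHr /andP[ir ur].
rewrite inE !big_cons; case: eqP => [mi _|/eqP mi /= mr].
  have ne l : l \in r -> l != m by move=> lr; apply: contraNneq ir; rewrite -mi => <-.
  rewrite -mi Xm mulrBl; congr (_ * _ - _ * _).
    by apply: eq_big_seq => l /ne/XY.
  by apply: eq_big_seq => l /ne/XZ.
by rewrite IHr// -XZ 1?eq_sym// -XY 1?eq_sym// mulrBr.
Qed.

Section Alternating.
Context {A : pzRingType} {N : nat} (T : 'I_N -> A).
Hypothesis commT : forall a b, T a * T b = T b * T a.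

Definition wedge (F : 'I_N -> A) : A :=
  \sum_(s : 'S_N) (-1) ^+ s * \prod_l rcomm (T (s l)) (F l).

(* Expand [rcomm (T (s i))] by the Leibniz rule: in all but one term a double commutator appears,
   symmetric in its two shifts by [rcommC], so that these terms cancel in pairs. *)
Lemma wedge_exact (F : 'I_N -> A) (i : 'I_N) :
  (forall x : A, - x = x -> x = 0) ->
  wedge F = \sum_(s : 'S_N) (-1) ^+ s * rcomm (T (s i))
    (\prod_l (if l == i then F l else rcomm (T (s l)) (F l))).
Proof.
move=> no2.
under [RHS]eq_bigr => s _ do rewrite rcomm_prod ?index_enum_uniq// mulr_sumr.
rewrite exchange_big/= (bigD1 i)//= [X in _ + X]big1 ?addr0.
  apply: eq_bigr => s _; congr (_ * _); apply: eq_bigr => l _.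
  by case: eqP => [->|].
(* Slot [m] carries the two shifts [s i] and [s m], slot [i] carries none. Exchanging these two
   values of [s] changes only the sign, so the sum is its own opposite. *)
move=> m mi; apply: no2.
rewrite [RHS](reindex_inj (mulgI (tperm i m))) /= -sumrN.
apply: eq_bigr => s _; rewrite odd_permM odd_tperm eq_sym mi/= signrN mulNr; congr (- (_ * _)).
apply: eq_bigr => l _; rewrite !permM tpermL.
case: (l =P m) => [->|/eqP lm].
  by rewrite (negPf mi) tpermR rcommC.
by case: (l =P i) => // /eqP li; rewrite tpermD 1?eq_sym.
Qed.

End Alternating.

Section Grid.
Context {N n : nat}.
Local Notation grid := {ffun 'I_N -> 'I_n.+1}.
Implicit Types (x y w : grid) (a b : 'I_N) (M : 'M[int]_#|{: grid}|) (f : grid -> int).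

(* Functions on the grid act as diagonal matrices; the commutator with the shift in direction [a]
   is the difference operator in direction [a], and [wedge] is a cup product of differentials. *)
Definition entry M x y : int := M (enum_rank x) (enum_rank y).
Definition grid_mx (e : grid -> grid -> int) : 'M[int]_#|{: grid}| :=
  \matrix_(i, j) e (enum_val i) (enum_val j).

Lemma entry_grid_mx e x y : entry (grid_mx e) x y = e x y.
Proof. by rewrite /entry mxE !enum_rankK. Qed.

Lemma entry_eqP M M' : (forall x y, entry M x y = entry M' x y) -> M = M'.
Proof. by move=> e; apply/matrixP => i j; rewrite -(enum_valK i) -(enum_valK j); exact: e. Qed.

Lemma entryM M M' x y : entry (M * M') x y = \sum_w entry M x w * entry M' w y.
Proof.
rewrite /entry mxE (reindex (@enum_rank grid)) //=.
by exists enum_val => ? _; rewrite ?enum_rankK ?enum_valK.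
Qed.

Lemma entryB M M' x y : entry (M - M') x y = entry M x y - entry M' x y.
Proof. by rewrite /entry !mxE. Qed.

Lemma entry1 x y : entry 1 x y = (x == y)%:R.
Proof. by rewrite /entry mxE (inj_eq enum_rank_inj). Qed.

Definition grid_step a x y := [forall j, y j == (x j + (j == a))%N :> nat].
Definition grid_shift a := grid_mx (fun x y => (grid_step a x y)%:R).
Definition grid_diag f := grid_mx (fun x y => (x == y)%:R * f x).

Lemma stepP a x y : reflect (forall j, y j = (x j + (j == a))%N :> nat) (grid_step a x y).
Proof. by apply: (iffP forallP) => h j; apply/eqP; apply: h. Qed.

Lemma step_inj_l a x x' y : grid_step a x y -> grid_step a x' y -> x = x'.
Proof.
move=> /stepP h /stepP h'; apply/ffunP => j; apply/val_inj => /=.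
by move: (h j) (h' j) => -> /addIn.
Qed.

Lemma step_inj_r a x y y' : grid_step a x y -> grid_step a x y' -> y = y'.
Proof. by move=> /stepP h /stepP h'; apply/ffunP => j; apply/val_inj; rewrite /= h h'. Qed.

Lemma stepE_l a y : reflect (exists x, grid_step a x y) (y a != ord0).
Proof.
apply: (iffP idP) => [ya|[x /stepP/(_ a)]].
  have lt j : (y j - (j == a) < n.+1)%N by rewrite ltnS (leq_trans (leq_subr _ _))// -ltnS.
  exists [ffun j => Ordinal (lt j)]; apply/stepP => j; rewrite ffunE /=.
  by rewrite subnK//; case: eqP => // ->; rewrite lt0n.
by rewrite eqxx addn1 => e; apply/eqP => /(congr1 val) /=; rewrite e.
Qed.

Lemma stepE_r a x : reflect (exists y, grid_step a x y) (x a != ord_max).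
Proof.
apply: (iffP idP) => [xa|[y /stepP/(_ a)]].
  have lt j : (x j + (j == a) < n.+1)%N.
    case: eqP => [->|_]; last by rewrite addn0.
    by rewrite addn1 ltnS ltn_neqAle -ltnS ltn_ord andbT.
  by exists [ffun j => Ordinal (lt j)]; apply/stepP => j; rewrite ffunE.
by rewrite eqxx addn1 => e; apply/eqP => xm; move: (ltn_ord (y a)); rewrite e xm ltnn.
Qed.

(** A step is a partial injection, so the sums in its matrix products have at most one nonzero term;
    [z] records where it is, if anywhere. *)
Lemma sum_step (P : pred grid) (g : grid -> int) (z : option grid) :
    (forall w, P w = (z == Some w)) ->
  \sum_w (P w)%:R * g w = if z is Some w then g w else 0.
Proof.
move=> Pz; case: z Pz => [w|] Pz; last by rewrite big1// => w _; rewrite Pz mul0r.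
rewrite (bigD1 w)//= Pz eqxx mul1r big1 ?addr0// => v vw; rewrite Pz.
by rewrite -[Some w == Some v]/(w == v) eq_sym (negPf vw) mul0r.
Qed.

(** Either product moves by one in both directions, in whichever order; if the intermediate point
    leaves the grid, so does the end point. *)
Lemma shiftC a b : grid_shift a * grid_shift b = grid_shift b * grid_shift a.
Proof.
suff H c d x y : entry (grid_shift c * grid_shift d) x y =
    [forall j, y j == (x j + (j == c) + (j == d))%N :> nat]%:R.
  apply/entry_eqP => x y; rewrite !H; congr (_%:R); congr nat_of_bool.
  by apply: eq_forallb => j; rewrite addnAC.
rewrite entryM; under eq_bigr => w _ do rewrite !entry_grid_mx.
case: (boolP (x c != ord_max)) => [/stepE_r[w xw]|xc].
  rewrite (@sum_step _ _ (Some w)) => [|v]; last first.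
    apply/idP/eqP => [xv|[<-]//]; congr Some; exact: step_inj_r xw xv.
  by congr (_%:R); congr nat_of_bool; apply: eq_forallb => j; move/stepP: xw => ->.
rewrite (@sum_step _ _ (None)) => [|v]; last first.
  by apply: contraNF xc => xv; apply/stepE_r; exists v.
case: forallP => // /(_ c)/eqP; rewrite eqxx => e; exfalso.
move: xc (ltn_ord (y c)); rewrite negbK e => /eqP ->/=.
by rewrite addn1 ltnNge ltnS leq_addr.
Qed.

Lemma entry_rcomm a f x y :
  entry (rcomm (grid_shift a) (grid_diag f)) x y = (grid_step a x y)%:R * (f y - f x).
Proof.
rewrite entryB !entryM mulrBr; congr (_ - _).
  rewrite (bigD1 y)//= !entry_grid_mx eqxx mul1r big1 ?addr0// => w wy.
  by rewrite !entry_grid_mx (negPf wy) mul0r mulr0.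
rewrite (bigD1 x)//= !entry_grid_mx eqxx mul1r mulrC big1 ?addr0// => w wx.
by rewrite !entry_grid_mx eq_sym (negPf wx) !mul0r.
Qed.

(** On a [wedge] this is the integral of a form of top degree over the grid. *)
Definition mx_total M : int := \sum_x \sum_y entry M x y.

Lemma totalB M M' : mx_total (M - M') = mx_total M - mx_total M'.
Proof.
rewrite /mx_total -sumrB; apply: eq_bigr => x _; rewrite -sumrB.
by apply: eq_bigr => y _; rewrite entryB.
Qed.

(* [inner a] is an ideal of the ring [flat a]; on it, no boundary term is left when the total of a
   commutator with the shift in direction [a] telescopes. *)
Definition flat a M := forall x y, entry M x y != 0 -> x a = y a.
Definition inner a M := forall x y, entry M x y != 0 ->
  [/\ x a = y a, x a != ord0 & x a != ord_max].

Lemma entryM_neq0 M M' x y : entry (M * M') x y != 0 ->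
  exists w, entry M x w != 0 /\ entry M' w y != 0.
Proof.
rewrite entryM.
case: (boolP [exists w, (entry M x w != 0) && (entry M' w y != 0)]).
  by case/existsP => w /andP[]; exists w.
move=> /existsPn h; rewrite big1 ?eqxx// => w _; move: (h w); rewrite negb_and !negbK.
by case/orP => /eqP ->; rewrite ?mul0r ?mulr0.
Qed.

Lemma flatM a M M' : flat a M -> flat a M' -> flat a (M * M').
Proof. by move=> h h' x y /entryM_neq0[w [/h -> /h' ->]]. Qed.

Lemma innerMl a M M' : inner a M -> flat a M' -> inner a (M * M').
Proof. by move=> h h' x y /entryM_neq0[w [/h[e ? ?] /h' <-]]; split. Qed.

Lemma innerMr a M M' : flat a M -> inner a M' -> inner a (M * M').
Proof. by move=> h h' x y /entryM_neq0[w [/h -> /h'[e ? ?]]]; split. Qed.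

Lemma flat_prod a (r : seq 'I_N) X : (forall l, flat a (X l)) -> flat a (\prod_(l <- r) X l).
Proof.
move=> h; apply: (big_ind (flat a)) => //; last exact: flatM.
by move=> x y; rewrite entry1; case: (x =P y) => [->|]; rewrite ?eqxx.
Qed.

Lemma inner_prod a (r : seq 'I_N) X m : (forall l, flat a (X l)) -> m \in r ->
  inner a (X m) -> inner a (\prod_(l <- r) X l).
Proof.
move=> h + hm; elim: r => // i r IHr; rewrite inE big_cons => /predU1P[<-|/IHr hr].
  by apply: innerMl => //; apply: flat_prod.
exact: innerMr.
Qed.

(** Multiplication by the shift on the left or right only relabels rows or columns. No entry of an
    inner matrix is pushed off the grid, so both products have the total of [M]. *)
Lemma total_shift a M : inner a M -> mx_total (rcomm (grid_shift a) M) = 0.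
Proof.
move=> hM; rewrite totalB; apply/eqP; rewrite subr_eq0; apply/eqP.
transitivity (mx_total M).
  rewrite /mx_total; under eq_bigr => x _ do under eq_bigr => y _ do rewrite entryM.
  under eq_bigr => x _ do rewrite exchange_big.
  rewrite exchange_big/=; apply: eq_bigr => w _.
  rewrite exchange_big/=; apply: eq_bigr => y _.
  rewrite -mulr_suml; have [->|/hM[_ w0 _]] := eqVneq (entry M w y) 0; first by rewrite mulr0.
  case/stepE_l: w0 => v vw; under eq_bigr => x _ do rewrite entry_grid_mx -[_%:R]mulr1.
  rewrite (@sum_step _ _ (Some v)) ?mul1r// => x.
  by apply/idP/eqP => [xw|[<-]//]; congr Some; exact: step_inj_l vw xw.
rewrite /mx_total; apply: eq_bigr => x _.
under [RHS]eq_bigr => y _ do rewrite entryM.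
rewrite exchange_big/=; apply: eq_bigr => w _.
rewrite -mulr_sumr; have [->|/hM[xw _]] := eqVneq (entry M x w) 0; first by rewrite mul0r.
rewrite xw => /stepE_r[v wv]; under eq_bigr => y _ do rewrite entry_grid_mx -[_%:R]mulr1.
rewrite (@sum_step _ _ (Some v)) ?mulr1// => y.
by apply/idP/eqP => [wy|[<-]//]; congr Some; exact: step_inj_r wv wy.
Qed.

Lemma flat_rcomm a b f : a != b -> flat a (rcomm (grid_shift b) (grid_diag f)).
Proof.
move=> ab x y; rewrite entry_rcomm; case: stepP => [h _|_]; last by rewrite mul0r eqxx.
by apply/val_inj; rewrite /= h (negPf ab) addn0.
Qed.

Lemma flat_diag a f : flat a (grid_diag f).
Proof. by move=> x y; rewrite entry_grid_mx; case: (x =P y) => [->|]; rewrite ?mul0r ?eqxx. Qed.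

Definition constant_on_faces a f := forall x y,
  (x a == ord0) || (x a == ord_max) -> x a = y a -> f x = f y.

(** A step in direction [b] stays inside a face orthogonal to [a], along which [f] does not vary. *)
Lemma inner_rcomm a b f : a != b -> constant_on_faces a f ->
  inner a (rcomm (grid_shift b) (grid_diag f)).
Proof.
move=> ab hf x y nz; have xy := flat_rcomm ab nz.
have faces : ~~ ((x a == ord0) || (x a == ord_max)).
  by apply: contra nz => xf; rewrite entry_rcomm (hf _ _ xf xy) subrr mulr0.
by move: faces; rewrite negb_or => /andP[].
Qed.

Lemma inner_diag a f : (forall x, (x a == ord0) || (x a == ord_max) -> f x = 0) ->
  inner a (grid_diag f).
Proof.
move=> hf x y nz; have xy := @flat_diag a _ _ _ nz.
have faces : ~~ ((x a == ord0) || (x a == ord_max)).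
  by apply: contra nz => xf; rewrite entry_grid_mx (hf _ xf) mulr0.
by move: faces; rewrite negb_or => /andP[].
Qed.

(** Discrete counterpart of the integral over the cube of the wedge of the differentials of the
    labels, which Stokes turns into a boundary quantity. *)
Definition grid_degree (f : 'I_N -> grid -> int) : int :=
  mx_total (wedge grid_shift (fun l => grid_diag (f l))).

Lemma total_sum (I : finType) (F : I -> 'M[int]_#|{: grid}|) :
  mx_total (\sum_i F i) = \sum_i mx_total (F i).
Proof.
apply: (big_morph mx_total) => [M M'|].
  rewrite /mx_total -big_split; apply: eq_bigr => x _; rewrite -big_split.
  by apply: eq_bigr => y _; rewrite /entry mxE.
by rewrite /mx_total big1// => x _; rewrite big1// => y _; rewrite /entry mxE.
Qed.

Lemma total_sign (s : 'S_N) M : mx_total ((-1) ^+ s * M) = (-1) ^+ s * mx_total M.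
Proof.
case: odd_perm; rewrite ?expr0 ?mul1r// ?expr1 !mulN1r -[- M]sub0r totalB.
by rewrite -[X in mx_total X](subrr M) totalB subrr sub0r.
Qed.

Lemma grid_degree_eq0 (f : 'I_N -> grid -> int) i :
  (forall x, (x i == ord0) || (x i == ord_max) -> f i x = 0) ->
  (forall a, a != i -> constant_on_faces a (f a)) -> grid_degree f = 0.
Proof.
move=> fi0 fa; rewrite /grid_degree (wedge_exact shiftC _ i); last first.
  move=> M MN; apply/matrixP => a b; apply/eqP; rewrite mxE -eqNr.
  by move/matrixP/(_ a b): MN; rewrite mxE => ->.
rewrite total_sum big1// => s _; rewrite total_sign total_shift ?mulr0//.
(* Factor number [s i] is inner in direction [s i]. If [s i = i], it is the undifferentiated [f i],
   zero on these faces; otherwise its label is constant on them and is differentiated in another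
   direction. *)
apply: (@inner_prod (s i) _ _ (s i)); rewrite ?mem_index_enum//.
  move=> l; case: eqP => [_|/eqP li]; first exact: flat_diag.
  by apply: flat_rcomm; rewrite (inj_eq perm_inj) eq_sym.
case: eqP => [-> |/eqP si]; first exact: inner_diag.
by apply: inner_rcomm; [rewrite (inj_eq perm_inj) eq_sym | exact: fa].
Qed.

Lemma diagB f g : grid_diag (fun x => f x - g x) = grid_diag f - grid_diag g.
Proof. by apply/entry_eqP => x y; rewrite entryB !entry_grid_mx mulrBr. Qed.

(** By multilinearity the difference is the degree with component [i] replaced by [f i - g i], which
    vanishes on the two faces orthogonal to [i]. *)
Lemma grid_degree_swap (f g : 'I_N -> grid -> int) i :
    (forall l, l != i -> f l = g l) ->
    (forall x, (x i == ord0) || (x i == ord_max) -> f i x = g i x) ->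
    (forall a, a != i -> constant_on_faces a (f a)) ->
  grid_degree f = grid_degree g.
Proof.
move=> fg fgi fa; apply/eqP; rewrite -subr_eq0 -totalB; apply/eqP.
pose u l := if l == i then (fun x => f l x - g l x) else f l.
rewrite -(@grid_degree_eq0 u i) /u ?eqxx //; last first.
- by move=> a ai; rewrite (negPf ai); exact: fa.
- by move=> x xi; rewrite fgi ?subrr.
rewrite /grid_degree /wedge -sumrB; congr mx_total; apply: eq_bigr => s _.
rewrite -mulrBr; congr (_ * _); symmetry; apply: (@prod_slotB _ _ _ i).
- exact: index_enum_uniq.
- exact: mem_index_enum.
- by rewrite eqxx diagB rcommB.
- by move=> l li; rewrite (negPf li).
- by move=> l li; rewrite (negPf li) fg.
Qed.

Lemma grid_degree_faces (f g : 'I_N -> grid -> int) :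
  (forall l x, x l == ord0 -> f l x = 0 /\ g l x = 0) ->
  (forall l x, x l == ord_max -> f l x = 1 /\ g l x = 1) -> grid_degree f = grid_degree g.
Proof.
(* In [F m] the first [m] components are already those of [g]; going from [m] to [m.+1] swaps a
   single one. *)
move=> h0 h1; pose F m (l : 'I_N) := if (l < m)%N then g l else f l.
have F0 m (l : 'I_N) x : x l == ord0 -> F m l x = 0 by rewrite /F; case: ifP => _ /h0[].
have F1 m (l : 'I_N) x : x l == ord_max -> F m l x = 1 by rewrite /F; case: ifP => _ /h1[].
have Fc m a : constant_on_faces a (F m a).
  move=> x y /orP[] xa xy; have ya := xa; rewrite xy in ya.
    by rewrite !F0.
  by rewrite !F1.
suff H m : (m <= N)%N -> grid_degree (F 0%N) = grid_degree (F m).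
  have -> : f = F 0%N by [].
  rewrite (H N (leqnn N)); congr grid_degree; apply/funext => l.
  by rewrite /F ltn_ord.
elim: m => [_|m IHm mN]; first by [].
rewrite (IHm (ltnW mN)).
apply: (@grid_degree_swap _ _ (Ordinal mN)) => [l lm|x|a _].
- rewrite /F ltnS (leq_eqVlt l).
  have /negPf -> : l != m :> nat by rewrite -val_eqE in lm.
  by [].
- by move=> /orP[] xa; [rewrite (F0 m) ?(F0 m.+1)|rewrite (F1 m) ?(F1 m.+1)].
- exact: Fc.
Qed.

(** Component [l] jumps only between levels 0 and 1 in direction [l], so the whole degree sits in
    the cell at the origin. *)
Definition canonical_label (l : 'I_N) x : int := (x l != ord0)%:R.

Lemma entry_canonical (r : seq 'I_N) x y : uniq r ->
  entry (\prod_(l <- r) rcomm (grid_shift l) (grid_diag (canonical_label l))) x y =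
  [forall j, if j \in r then (x j == 0 :> nat) && (y j == 1 :> nat) else x j == y j]%:R.
Proof.
elim: r x => [|i r IHr] x /=.
  move=> _; rewrite big_nil entry1; congr (_%:R); congr nat_of_bool.
  by apply/eqP/forallP => [-> j|h]; [|apply/ffunP => j; exact/eqP/h].
case/andP=> ir ur; rewrite big_cons entryM.
pose Q w := grid_step i x w && (x i == ord0).
transitivity (\sum_w (Q w)%:R *
  [forall j, if j \in r then (w j == 0 :> nat) && (y j == 1 :> nat) else w j == y j]%:R : int).
  apply: eq_bigr => w _; rewrite entry_rcomm IHr//; congr (_ * _); rewrite /Q.
  case: stepP => [xw|]; last by rewrite mul0r.
  have wi0 : w i != ord0 by rewrite -val_eqE /= xw eqxx addn1.
  by rewrite /canonical_label wi0 mul1r; case: eqP.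
have [x0|x0] := eqVneq (x i) ord0; last first.
  rewrite big1 => [|w _]; last by rewrite /Q (negPf x0) andbF mul0r.
  by case: forallP => // /(_ i); rewrite inE eqxx/= => /andP[/eqP x0' _];
    rewrite -val_eqE /= x0' in x0.
have [/stepE_r[w xw]|] := boolP (x i != ord_max).
  rewrite (@sum_step _ _ (Some w)) => [|v]; last first.
    rewrite /Q x0 eqxx andbT.
    by apply/idP/eqP => [xv|[<-]//]; congr Some; exact: step_inj_r xw xv.
  congr (_%:R); congr nat_of_bool; apply: eq_forallb => j.
  have -> : (w j == y j) = (w j == y j :> nat) by [].
  have -> : (x j == y j) = (x j == y j :> nat) by [].
  move/stepP: xw => ->; rewrite inE; case: (j =P i) => [->|_] /=; last by rewrite addn0.
  by rewrite (negPf ir) x0/= eq_sym.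
rewrite negbK => /eqP xm; rewrite (@sum_step _ _ None) => [|w]; last first.
  rewrite /Q; apply/negP => /andP[h _]; suff : x i != ord_max by rewrite xm eqxx.
  by apply/stepE_r; exists w.
case: forallP => // /(_ i); rewrite inE eqxx /= => /andP[_ /eqP y1].
have := ltn_ord (y i); rewrite y1 ltnS.
by have /= := congr1 val xm; rewrite x0 /= => <-.
Qed.

Lemma prod_eq0 (A : pzRingType) (r : seq 'I_N) (X : 'I_N -> A) l :
  l \in r -> X l = 0 -> \prod_(l <- r) X l = 0.
Proof.
move=> + X0; elim: r => // i r IHr; rewrite inE big_cons => /predU1P[<-|/IHr ->].
  by rewrite X0 mul0r.
by rewrite mulr0.
Qed.

Lemma grid_degree_canonical : (0 < n)%N -> grid_degree canonical_label = 1.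
Proof.
move=> n0; rewrite /grid_degree total_sum (bigD1 1%g) //= [X in _ + X]big1 ?addr0; last first.
  (* A permutation other than the identity differentiates some label [l] in a direction in which it
     is constant. *)
  move=> s s1; have [l sl] : exists l, s l != l.
    apply/existsP; apply: contraNT s1 => /existsPn h; apply/eqP/permP => l.
    by rewrite perm1; apply/eqP; move: (h l); rewrite negbK.
  rewrite (prod_eq0 (mem_index_enum l)) ?mulr0//.
    by rewrite /mx_total big1// => x _; rewrite big1// => y _; rewrite /entry mxE.
  apply/entry_eqP => x y; rewrite entry_rcomm /canonical_label.
  case: stepP => [xy|]; last by rewrite mul0r /entry mxE.
  by rewrite -!val_eqE /= xy [l == s l]eq_sym (negPf sl) addn0 subrr mulr0 /entry mxE.
rewrite odd_perm1 expr0 mul1r.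
(* The one nonzero entry joins the two opposite corners of the first cell; [inord 1] is level 1
   because [n] is positive. *)
pose x0 : grid := [ffun => ord0]; pose y1 : grid := [ffun => inord 1].
transitivity (mx_total (\prod_l rcomm (grid_shift l) (grid_diag (canonical_label l)))).
  by congr mx_total; apply: eq_bigr => l _; rewrite perm1.
have E x y : entry (\prod_l rcomm (grid_shift l) (grid_diag (canonical_label l))) x y
    = ((x == x0) && (y == y1))%:R.
  rewrite entry_canonical ?index_enum_uniq//; congr (_%:R); congr nat_of_bool.
  apply/forallP/andP => [h|[/eqP -> /eqP ->] j].
    split; apply/eqP/ffunP => j; rewrite ffunE; move: (h j);
    rewrite mem_index_enum => /andP[/eqP xj /eqP yj];
    by apply/val_inj; rewrite /= ?inordK.
  by rewrite mem_index_enum !ffunE /= inordK ?eqxx.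
rewrite /mx_total (bigD1 x0)//= (bigD1 y1)//= E !eqxx.
rewrite big1 => [|y /negPf yy]; last by rewrite E yy andbF.
rewrite addr0 big1 ?addr0// => x /negPf xx.
by rewrite big1// => y _; rewrite E xx.
Qed.

(** A nonzero entry comes from a monotone path from [x] to [y] with one step per factor, and factor
    [l] contributes the increment of [f l] along its step. *)
Lemma entry_prod_cell (r : seq 'I_N) (s : 'S_N) (f : 'I_N -> grid -> int) x y : uniq r ->
  entry (\prod_(l <- r) rcomm (grid_shift (s l)) (grid_diag (f l))) x y != 0 ->
  (forall j, x j <= y j <= x j + (j \in map s r))%N /\
  (forall l, l \in r -> exists z z' : grid, [/\ forall j, (x j <= z j <= y j)%N,
    forall j, (x j <= z' j <= y j)%N & f l z != f l z']).
Proof.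
elim: r x => [|i r IHr] x /=.
  by move=> _; rewrite big_nil entry1; case: (x =P y) => // -> _; split=> // j; rewrite addn0 leqnn.
case/andP => ir ur; rewrite big_cons => /entryM_neq0[w []].
rewrite entry_rcomm; case: stepP => [xw|]; last by rewrite mul0r eqxx.
rewrite mul1r subr_eq0 => fw /(IHr _ ur)[wy H].
have xwj j : (x j <= w j)%N by rewrite xw leq_addr.
have sir : s i \notin map s r by rewrite (mem_map perm_inj).
split=> [j|l].
  move: (wy j) => /andP[wj1 wj2]; rewrite (leq_trans (xwj j) wj1) (leq_trans wj2)// xw inE.
  by case: (j =P s i) => [->|_] /=; rewrite ?(negPf sir) ?addn0// addn0.
have wyj j : (w j <= y j)%N by case/andP: (wy j).
rewrite inE => /predU1P[->|/H [z [z' [zj z'j fz]]]].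
  by exists w, x; split=> // j; rewrite ?xwj ?wyj ?leqnn ?(leq_trans (xwj j)).
exists z, z'; split=> // j; [move: (zj j)|move: (z'j j)] => /andP[a ->]; rewrite andbT;
  exact: leq_trans (xwj j) a.
Qed.

(** A cubical counterpart of Sperner's lemma: the labels on the faces force degree 1, so some
    product has a nonzero entry, and its path stays in one cell and meets a change of every
    label. *)
Theorem labelled_cell (f : 'I_N -> grid -> bool) : (0 < n)%N ->
    (forall l x, x l = ord0 -> f l x = false) ->
    (forall l x, x l = ord_max -> f l x = true) ->
  exists x, forall l, exists z z' : grid, [/\ forall j, (x j <= z j <= (x j).+1)%N,
    forall j, (x j <= z' j <= (x j).+1)%N & f l z != f l z'].
Proof.
move=> n0 f0 f1; pose F l x : int := (f l x)%:R.
have maxn0 : ord_max != ord0 :> 'I_n.+1 by rewrite -val_eqE /= -lt0n.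
have dF : grid_degree F != 0.
  rewrite (@grid_degree_faces _ canonical_label) ?grid_degree_canonical ?oner_eq0// => l x /eqP xl.
    by rewrite /F f0// /canonical_label xl eqxx.
  by rewrite /F f1// /canonical_label xl maxn0.
have [/existsP[s /existsP[x /existsP[y nz]]]|] := boolP [exists s : 'S_N, exists x, exists y,
    entry (\prod_l rcomm (grid_shift (s l)) (grid_diag (F l))) x y != 0].
  have [xy H] := entry_prod_cell (index_enum_uniq _) nz.
  have yx j : (y j <= (x j).+1)%N.
    by case/andP: (xy j) => _ /leq_trans; apply; rewrite -(addn1 (x j)) leq_add2l leq_b1.
  exists x => l; have [z [z' [zj z'j fz]]] := H l (mem_index_enum l).
  exists z, z'; split=> [j|j|]; [case/andP: (zj j)|case/andP: (z'j j)|].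
  - by move=> -> /leq_trans ->.
  - by move=> -> /leq_trans ->.
  - by apply: contra_neq fz => e; rewrite /F e.
move=> /existsPn h; case/eqP: dF; rewrite /grid_degree total_sum big1// => s _.
rewrite total_sign /mx_total big1 ?mulr0// => x _; rewrite big1// => y _; apply/eqP.
by move: (h s) => /existsPn/(_ x)/existsPn/(_ y); rewrite negbK.
Qed.

End Grid.

(** * The Poincare-Miranda theorem *)

Section PoincareMiranda.
Context {R : realType}.

Lemma cvg_mx (T : Type) (F : set_system T) {FF : Filter F} m n
    (f : T -> 'M[R]_(m, n)) (M : 'M[R]_(m, n)) :
  (forall i j, (fun t => f t i j) @ F --> M i j) -> f @ F --> M.
Proof.
move=> cf; apply/cvg_ballP => e e0.
suff : \forall t \near F, forall i j, ball (M i j) e (f t i j).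
  by apply: filterS => t h; split.
apply: filter_forall => i; apply: filter_forall => j.
by have /cvg_ballP := cf i j; apply.
Qed.

Lemma mx_continuous (T : topologicalType) m n (f : T -> 'M[R]_(m, n)) :
  (forall i j, continuous (fun t => f t i j)) -> continuous f.
Proof. by move=> cf t; apply: cvg_mx => i j; exact: cf. Qed.

Context {N : nat} (lo hi : 'I_N -> R).
Hypothesis lohi : forall i, lo i < hi i.

Definition box : set 'rV[R]_N := [set z | forall i, lo i <= z 0 i <= hi i].

Lemma box_compact : compact box.
Proof.
rewrite (_ : box = [set z : 'rV[R]_N | forall i, `[lo i, hi i]%classic (z ord0 i)]).
  by apply: (@rV_compact R N (fun i => `[lo i, hi i]%classic)) => i; exact: segment_compact.
by apply/seteqP; split => z h i; move: (h i); rewrite /= in_itv.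
Qed.

Let gridpt n (x : {ffun 'I_N -> 'I_n.+1}) : 'rV[R]_N :=
  \row_i (lo i + (x i)%:R / n%:R * (hi i - lo i)).

Let gridpt_box n (x : {ffun 'I_N -> 'I_n.+1}) : (0 < n)%N -> box (gridpt x).
Proof.
move=> n0 i; rewrite mxE; have w0 : 0 <= hi i - lo i by rewrite subr_ge0 ltW.
rewrite lerDl mulr_ge0//= ?divr_ge0// -lerBrDl ler_piMl//.
by rewrite ler_pdivrMr ?ltr0n// mul1r ler_nat -ltnS.
Qed.

Let gridpt_close n (x z : {ffun 'I_N -> 'I_n.+1}) d : (0 < n)%N ->
  \sum_i (hi i - lo i) < d * n%:R ->
  (forall j, x j <= z j <= (x j).+1)%N -> ball (gridpt x) d (gridpt z).
Proof.
move=> n0 sd xz.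
have nR : 0 < n%:R :> R by rewrite ltr0n.
have wi0 i : 0 <= hi i - lo i by rewrite subr_ge0 ltW.
have w0 : 0 <= \sum_i (hi i - lo i) by exact: sumr_ge0.
have d0 : 0 < d by rewrite -(pmulr_lgt0 _ nR) (le_lt_trans w0).
split=> // i j; rewrite !mxE -ball_normE /ball_ /=.
rewrite opprD addrACA subrr add0r -mulrBl -mulrBl normrM (ger0_norm (wi0 j)).
rewrite normrM normfV (ger0_norm (ltW nR)).
rewrite mulrAC ltr_pdivrMr//; apply: le_lt_trans sd.
rewrite (bigD1 j)//= -[leLHS]addr0 lerD ?sumr_ge0//.
rewrite ler_piMl// distrC -natrB; last by case/andP: (xz j).
by rewrite normr_nat -[1]/(1%:R) ler_nat leq_subLR addn1; case/andP: (xz j).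
Qed.

Theorem poincare_miranda (g : 'rV[R]_N -> 'rV[R]_N) : continuous g ->
    (forall z i, box z -> z 0 i = lo i -> g z 0 i <= 0) ->
    (forall z i, box z -> z 0 i = hi i -> 0 <= g z 0 i) ->
  exists2 z, box z & g z = 0.
Proof.
move=> cg glo ghi; apply: contrapT => noz.
(* Without a zero, compactness yields one radius [d] such that on each [d]-ball centred in the box
   some component of [g] keeps a strict sign. A cell of smaller size in which every component
   changes sign contradicts this. *)
pose P (d : R) (z : 'rV[R]_N) := exists i,
  (forall z', ball z d z' -> 0 < g z' 0 i) \/ (forall z', ball z d z' -> g z' 0 i < 0).
have cgi i : continuous (fun z => g z 0 i).
  move=> z; exact: (continuous_comp (@cg z) (@coord_continuous _ _ _ _ _ _)).
have : \forall d \near 0^'+, box `<=` P d.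
  have /compact_near_coveringP := box_compact; apply => z bz.
  have [i gi] : exists i, g z 0 i != 0.
    apply/existsP; apply: contra_notT noz => /existsPn h; exists z => //.
    by apply/rowP => i; rewrite mxE; apply/eqP; move: (h i); rewrite negbK.
  have [e e0 he] : exists2 e, 0 < e &
      (forall z', ball z e z' -> 0 < g z' 0 i) \/ (forall z', ball z e z' -> g z' 0 i < 0).
    have [gp|gn|g0] := ltgtP 0 (g z 0 i); last by rewrite -g0 eqxx in gi.
      have [e e0 he] := (nbhs_ballP z _).1 (cvgr_gt _ (@cgi i z) _ gp).
      by exists e => //; left.
    have [e e0 he] := (nbhs_ballP z _).1 (cvgr_lt _ (@cgi i z) _ gn).
      by exists e => //; right.
  near=> z' d; exists i.
  have zz' : ball z (e / 2) z'.
    by near: z'; apply: nbhsx_ballx; rewrite divr_gt0.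
  have d2 : d <= e / 2 by near: d; apply: nbhs_right_le; rewrite divr_gt0.
  have sub : ball z' d `<=` ball z e.
    move=> w /(le_ball d2) z'w; rewrite [e]splitr; exact: ball_triangle zz' z'w.
  by case: he => he; [left|right] => w /sub /he.
move=> nearP; have [d [dp boxP]] : exists d : R, 0 < d /\ box `<=` P d.
  apply: (@filter_ex _ (0^'+ : set_system R)).
  by apply: filterI; [exact: nbhs_right_gt|exact: nearP].
(* The sum of the widths bounds each of them, so cells of the grid with [n] subdivisions have sides
   shorter than [d]. *)
pose n := (Num.bound `|\sum_i (hi i - lo i) / d|).+1.
have n0 : (0 < n)%N by [].
have sd : \sum_i (hi i - lo i) < d * n%:R.
  rewrite mulrC -ltr_pdivrMr// mulr_suml; apply: le_lt_trans (ler_norm _) _.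
  by rewrite (lt_le_trans (archi_boundP (normr_ge0 _)))// ler_nat.
(* The sign of [g], but forced on the faces, where the hypotheses give only weak inequalities; the
   labels therefore also imply only weak ones, enough against strict signs. *)
pose lab (l : 'I_N) (x : {ffun 'I_N -> 'I_n.+1}) :=
  (x l == ord_max) || ((x l != ord0) && (0 < g (gridpt x) 0 l)).
have [| |x cell] := @labelled_cell N n lab n0.
- by move=> l x xl; rewrite /lab xl eqxx.
- by move=> l x xl; rewrite /lab xl eqxx.
have lab0 l z : lab l z = false -> g (gridpt z) 0 l <= 0.
  rewrite /lab; case: eqP => //= _; have [z0 _|_ /negbT] := eqVneq (z l) ord0.
    by apply: glo; [exact: gridpt_box | rewrite mxE z0 mul0r mul0r addr0].
  by rewrite -leNgt.
have lab1 l z : lab l z = true -> 0 <= g (gridpt z) 0 l.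
  rewrite /lab; case: eqP => [z1 _|_ /andP[_ /ltW //]].
  apply: ghi; first exact: gridpt_box.
  by rewrite mxE z1 /= divff ?pnatr_eq0// mul1r addrC subrK.
have [i hi'] := boxP _ (gridpt_box x n0).
have [z [z' [xz xz']]] := cell i.
have bz := gridpt_close n0 sd xz; have bz' := gridpt_close n0 sd xz'.
case E : (lab i z); case E' : (lab i z') => // _.
  by case: hi' => [/(_ _ bz')|/(_ _ bz)]; rewrite ltNge ?lab0 ?lab1.
by case: hi' => [/(_ _ bz)|/(_ _ bz')]; rewrite ltNge ?lab0 ?lab1.
Unshelve. all: by end_near. Qed.

End PoincareMiranda.

(** * Essential maps on a box *)

Lemma pair_continuous (S T U : topologicalType) (f : S -> T) (g : S -> U) :
  continuous f -> continuous g -> continuous (fun x => (f x, g x)).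
Proof. by move=> cf cg x; apply: cvg_pair; [exact: cf|exact: cg]. Qed.

Section Essential.
Context {R : realType} {N : nat} (lo hi : 'I_N -> R).
Implicit Types (z : 'rV[R]_N) (f g : 'rV[R]_N -> 'rV[R]_N).

Definition box_boundary : set 'rV[R]_N :=
  [set z | box lo hi z /\ exists i, z 0 i = lo i \/ z 0 i = hi i].

(** Stands in for a nonzero degree: the zero cannot be removed by a change in the interior of the
    box. *)
Definition essential f := forall g, continuous g ->
  (forall z, box_boundary z -> g z = f z) -> exists2 z, box lo hi z & g z = 0.

Lemma box_boundary_closed : closed box_boundary.
Proof.
rewrite (_ : box_boundary = box lo hi `&`
    \bigcup_(i in [set: 'I_N]) [set z | z 0 i = lo i \/ z 0 i = hi i]); last first.
  by apply/seteqP; split=> z [bz [i]]; [move=> zi|move=> _ zi]; split=> //; exists i.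
apply: closedI; first by apply: compact_closed; [exact: norm_hausdorff|exact: box_compact].
apply: closed_bigcup => [|i _]; first exact: finite_finset.
have cl (a : R) : closed [set z : 'rV[R]_N | z 0 i = a].
  rewrite (_ : [set z : 'rV[R]_N | z 0 i = a] = (fun z : 'rV[R]_N => z 0 i) @^-1` [set a])//.
  apply: preimage_closed; first by move=> z _; exact: coord_continuous.
  exact: closed_eq.
exact: (closedU (cl (lo i)) (cl (hi i))).
Qed.

Lemma essential_subr (a : 'rV[R]_N) : (forall i, lo i < a 0 i < hi i) -> essential (fun z => z - a).
Proof.
move=> loahi g cg gz; apply: poincare_miranda => //.
- by move=> i; case/andP: (loahi i); exact: lt_trans.
- move=> z i bz zi; rewrite gz; last by split=> //; exists i; left.
  by rewrite !mxE zi subr_le0 ltW//; case/andP: (loahi i).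
- move=> z i bz zi; rewrite gz; last by split=> //; exists i; right.
  by rewrite !mxE zi subr_ge0 ltW//; case/andP: (loahi i).
Qed.

(* The homotopy is run for a time that is a Urysohn function, equal to 0 on the boundary
   and to 1 at all points where it vanishes at some time. *)
Lemma essential_homotopy (h : R -> 'rV[R]_N -> 'rV[R]_N) :
    continuous (fun p : R * 'rV[R]_N => h p.1 p.2) ->
    (forall t z, 0 <= t <= 1 -> box_boundary z -> h t z != 0) ->
  essential (h 0) -> essential (h 1).
Proof.
move=> ch h0 eh g cg gh.
(* Corrected so as to end at [g] instead of [h 1], without any change on the boundary, where the two
   agree. *)
pose H (p : R * 'rV[R]_N) := h p.1 p.2 + p.1 *: (g p.2 - h 1 p.2).
have cH : continuous H.
  have c1 : continuous (fun p : R * 'rV[R]_N => (1 : R, p.2)).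
    by apply: pair_continuous => p; [exact: cvg_cst|exact: cvg_snd].
  move=> p; apply: cvgD; first exact: ch.
  apply: cvgZ; first exact: cvg_fst.
  apply: cvgB; first by apply: continuous_comp; [exact: cvg_snd|exact: cg].
  exact: (continuous_comp (c1 p) (ch (1, p.2))).
have Hbd t z : box_boundary z -> H (t, z) = h t z.
  by move=> bz; rewrite /H /= gh// subrr scaler0 addr0.
pose K := (`[0, 1]%classic `*` box lo hi) `&` (H @^-1` [set 0]).
pose Z := snd @` K.
have cZ : closed Z.
  apply: compact_closed; first exact: norm_hausdorff.
  apply: continuous_compact; first by apply: continuous_subspaceT => p; exact: cvg_snd.
  apply: compact_closedI.
    by apply: compact_setX; [exact: segment_compact|exact: box_compact].
  apply: preimage_closed; first by move=> p _; exact: cH.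
  by apply: accessible_closed_set1; apply: hausdorff_accessible; exact: norm_hausdorff.
have ZB : box_boundary `&` Z = set0.
  rewrite -subset0 => z [bz [[t z'] [[/= t01 _] Hz] /= zz']].
  have t01' : 0 <= t <= 1 by move: t01; rewrite in_itv.
  move: bz; rewrite -zz' => bz; move: Hz; rewrite /= Hbd//.
  by apply/eqP; exact: h0.
have sep := (@normal_separatorP R _).1 pseudometric_normal _ _ box_boundary_closed cZ ZB.
pose lam := @Urysohn _ R box_boundary Z.
have lam0 z : box_boundary z -> lam z = 0.
  by move=> bz; apply: (Urysohn_sub0 sep); exists z.
have lam1 z : Z z -> lam z = 1 by move=> Zz; apply: (Urysohn_sub1 sep); exists z.
have lam01 z : 0 <= lam z <= 1.
  by have := @Urysohn_range _ R box_boundary Z (lam z); rewrite /= in_itv; apply; exists z.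
have [|z bz|z bz Hz] := eh (fun z => H (lam z, z)).
- move=> z; apply: (continuous_comp _ (cH (lam z, z))).
  by apply: pair_continuous => {}z; [exact: Urysohn_continuous|exact: cvg_id].
- by rewrite lam0// Hbd.
exists z => //; rewrite -Hz lam1 /H /=; first by rewrite scale1r addrC subrK.
by exists (lam z, z) => //; split=> //; split=> //=; rewrite in_itv/= lam01.
Qed.

End Essential.

(** * Euclidean inner product and norm, and their comparison with the sup norm *)

Section Euclid.
Context {R : realType} {k : nat}.
Implicit Types (x y w : 'cV[R]_k) (c : R).

Lemma dotpE x y : dotp x y = (x^T *m y) 0 0.
Proof. by rewrite mxE; apply: eq_bigr => i _; rewrite mxE. Qed.

Lemma dotpC x y : dotp x y = dotp y x.
Proof. by apply: eq_bigr => i _; rewrite mulrC. Qed.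

Lemma dotpDr x y w : dotp x (y + w) = dotp x y + dotp x w.
Proof. by rewrite -big_split; apply: eq_bigr => i _; rewrite mxE mulrDr. Qed.

Lemma dotpDl x y w : dotp (x + y) w = dotp x w + dotp y w.
Proof. by rewrite dotpC dotpDr !(dotpC w). Qed.

Lemma dotpZr c x y : dotp x (c *: y) = c * dotp x y.
Proof. by rewrite /dotp mulr_sumr; apply: eq_bigr => i _; rewrite mxE mulrCA. Qed.

Lemma dotpZl c x y : dotp (c *: x) y = c * dotp x y.
Proof. by rewrite dotpC dotpZr dotpC. Qed.

Lemma dotpNr x y : dotp x (- y) = - dotp x y.
Proof. by rewrite -scaleN1r dotpZr mulN1r. Qed.

Lemma dotpNl x y : dotp (- x) y = - dotp x y.
Proof. by rewrite dotpC dotpNr dotpC. Qed.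

Lemma dotp0r x : dotp x 0 = 0.
Proof. by rewrite /dotp big1// => i _; rewrite mxE mulr0. Qed.

Lemma dotp0l x : dotp 0 x = 0.
Proof. by rewrite dotpC dotp0r. Qed.

Lemma dotp_mulmx (A : 'M[R]_k) x y : dotp x (A *m y) = dotp (A^T *m x) y.
Proof. by rewrite !dotpE trmx_mul trmxK mulmxA. Qed.

Lemma dotp_ge0 x : 0 <= dotp x x.
Proof. by apply: sumr_ge0 => i _; rewrite -expr2 sqr_ge0. Qed.

Lemma dotp_eq0 x : dotp x x = 0 -> x = 0.
Proof.
move=> /psumr_eq0P h; apply/colP => i; rewrite mxE; apply/eqP.
by rewrite -sqrf_eq0 expr2 h// => j _; rewrite -expr2 sqr_ge0.
Qed.

Lemma dotp_gt0 x : x != 0 -> 0 < dotp x x.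
Proof. by move=> x0; rewrite lt_def dotp_ge0 andbT; apply: contra_neq x0 => /dotp_eq0. Qed.

Lemma enorm_ge0 x : 0 <= enorm x.
Proof. exact: sqrtr_ge0. Qed.

Lemma enorm_gt0 x : x != 0 -> 0 < enorm x.
Proof. by move=> x0; rewrite sqrtr_gt0 dotp_gt0. Qed.

Lemma enorm0 : enorm (0 : 'cV[R]_k) = 0.
Proof. by rewrite /enorm dotp0r sqrtr0. Qed.

Lemma enormZ c x : enorm (c *: x) = `|c| * enorm x.
Proof. by rewrite /enorm dotpZl dotpZr mulrA -expr2 sqrtrM ?sqr_ge0// sqrtr_sqr. Qed.

Lemma sqr_enorm x : enorm x ^+ 2 = dotp x x.
Proof. by rewrite sqr_sqrtr ?dotp_ge0. Qed.

Lemma sphere_dotp x : sphere k x <-> dotp x x = 1.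
Proof.
rewrite /sphere /=; split=> [h|h]; first by rewrite -sqr_enorm h expr1n.
by rewrite /enorm h sqrtr1.
Qed.

Lemma sphere_neq0 x : sphere k x -> x != 0.
Proof.
move/sphere_dotp => h; apply/eqP => x0; move: h.
by rewrite x0 dotp0r => /esym/eqP; rewrite oner_eq0.
Qed.

Lemma sphere_normalize x : x != 0 -> sphere k ((enorm x)^-1 *: x).
Proof.
by move=> x0; rewrite /sphere /= enormZ normfV ger0_norm ?enorm_ge0// mulVf// gt_eqF ?enorm_gt0.
Qed.

Lemma coord_le_norm m n (M : 'M[R]_(m, n)) i j : `|M i j| <= `|M|.
Proof.
by rewrite -[leRHS]/(mx_norm M) mx_normrE; exact: (le_bigmax _ (fun ij => `|M ij.1 ij.2|) (i, j)).
Qed.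

Lemma norm_le_coord m n (M : 'M[R]_(m, n)) c :
  0 <= c -> (forall i j, `|M i j| <= c) -> `|M| <= c.
Proof.
move=> c0 h; rewrite -[leLHS]/(mx_norm M) mx_normrE.
by apply/bigmax_leP; split=> // -[i j] _; exact: h.
Qed.

Lemma ler_sum_const (F : 'I_k -> R) c : (forall i, F i <= c) -> \sum_i F i <= k%:R * c.
Proof.
move=> h; apply: (@le_trans _ _ (\sum_(i < k) c)); first by apply: ler_sum => i _.
by rewrite sumr_const card_ord mulr_natl.
Qed.

Lemma norm_dotp_le x y : `|dotp x y| <= k%:R * `|x| * `|y|.
Proof.
apply: (le_trans (ler_norm_sum _ _ _)).
rewrite -mulrA; apply: ler_sum_const => i.
by rewrite normrM ler_pM// coord_le_norm.
Qed.

Lemma norm_mulmx_le (A : 'M[R]_k) x : `|A *m x| <= k%:R * `|A| * `|x|.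
Proof.
apply: norm_le_coord => [|i j]; first by rewrite !mulr_ge0.
rewrite mxE; apply: (le_trans (ler_norm_sum _ _ _)).
rewrite -mulrA; apply: ler_sum_const => l.
by rewrite normrM ler_pM// coord_le_norm.
Qed.

Lemma dotp_continuous (T : topologicalType) (f g : T -> 'cV[R]_k) :
  continuous f -> continuous g -> continuous (fun t => dotp (f t) (g t)).
Proof.
move=> cf cg; apply: continuous_big => [|i _ t]; first exact: add_continuous.
apply: cvgM.
  exact: (continuous_comp (cf t) (@coord_continuous _ _ _ _ _ _)).
exact: (continuous_comp (cg t) (@coord_continuous _ _ _ _ _ _)).
Qed.

Lemma enorm_continuous : continuous (@enorm R k).
Proof.
move=> x; have cd : continuous (fun y : 'cV[R]_k => dotp y y).
  by apply: dotp_continuous => y; exact: cvg_id.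
exact: (continuous_comp (cd x) (@sqrt_continuous _ _)).
Qed.

End Euclid.

(** * Small inscribed simplices *)

Section Radial.
Context {R : realType} {k : nat}.
Implicit Types (f : 'cV[R]_k -> 'cV[R]_k) (x v w : 'cV[R]_k).

Lemma radial_sphere f x : sphere k x -> radial f x = f x.
Proof. by rewrite /sphere /radial /= => ->; rewrite invr1 scale1r. Qed.

Lemma radialZ f x (c : R) : 0 < c -> radial f (c *: x) = radial f x.
Proof.
move=> c0; rewrite /radial enormZ gtr0_norm// scalerA invfM mulrAC mulVf ?mul1r//.
by rewrite gt_eqF.
Qed.

Lemma derive_radial_self f x : 'D_x (radial f) x = 0.
Proof.
apply: cvg_lim => //; apply: cvg_near_cst.
near=> h; rewrite /= (_ : h *: x + x = (h + 1) *: x); last by rewrite scalerDl scale1r.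
rewrite radialZ ?subrr ?scaler0//.
have : `|h| < 1 by near: h; apply: dnbhs0_lt.
by rewrite ltr_norml => /andP[]; lra.
Unshelve. all: by end_near. Qed.

End Radial.

Lemma sub_mxE (V : zmodType) m n (A B : 'M[V]_(m, n)) i j : (A - B) i j = A i j - B i j.
Proof. by rewrite !mxE. Qed.

Section Isotopy.
Context {R : realType} {k : nat} (W : set R) (F : R -> 'cV[R]_k -> 'cV[R]_k).
Hypothesis smF : smooth_on [set p : R * 'cV[R]_k | W p.1 /\ p.2 != 0]
                  (fun p : R * 'cV[R]_k => radial (F p.1) p.2).
Let G (p : R * 'cV[R]_k) := radial (F p.1) p.2.
Implicit Types (t : R) (x v w : 'cV[R]_k).

Let diffG t x : W t -> x != 0 -> differentiable G (t, x).
Proof. by move=> Wt x0; apply: (smF [::]). Qed.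

Lemma isotopy_continuous t x : W t -> x != 0 -> {for (t, x), continuous G}.
Proof. by move=> Wt x0; exact: differentiable_continuous (diffG Wt x0). Qed.

Definition jacob t x : 'M[R]_k := \matrix_(i, j) 'D_(0, delta_mx j 0) G (t, x) i 0.

Lemma jacobE t x w : W t -> x != 0 -> 'D_(0, w) G (t, x) = jacob t x *m w.
Proof.
move=> Wt x0; have dG := diffG Wt x0; rewrite deriveE//.
have -> : (0 : R, w) = \sum_j w j 0 *: (0, delta_mx j 0).
  have e (r : seq 'I_k) : \sum_(j <- r) w j 0 *: (0 : R, delta_mx j 0 : 'cV[R]_k) =
      (0, \sum_(j <- r) w j 0 *: delta_mx j 0).
    elim: r => [|j r IHr]; first by rewrite !big_nil.
    by rewrite !big_cons IHr; congr (_, _); rewrite /= scaler0 addr0.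
  rewrite e; congr (_, _); rewrite [LHS]matrix_sum_delta.
  by apply: eq_bigr => j _; rewrite big_ord1.
rewrite linear_sum; apply/colP => i; rewrite summxE mxE; apply: eq_bigr => j _.
by rewrite linearZ !mxE mulrC deriveE.
Qed.

Lemma derive_slice t x w : 'D_w (radial (F t)) x = 'D_(0, w) G (t, x).
Proof.
rewrite /derive.
suff -> : (fun h => h^-1 *: ((radial (F t) \o shift x) (h *: w) - radial (F t) x)) =
    (fun h => h^-1 *: ((G \o shift (t, x)) (h *: (0, w)) - G (t, x))) by [].
by apply/funext => h; rewrite /G /= scaler0 add0r.
Qed.

Lemma jacob_radial t x : W t -> x != 0 -> jacob t x *m x = 0.
Proof. by move=> Wt x0; rewrite -jacobE// -derive_slice derive_radial_self. Qed.

Lemma jacob_continuous t x i j : W t -> x != 0 ->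
  {for (t, x), continuous (fun p => jacob p.1 p.2 i j)}.
Proof.
move=> Wt x0; have dG : differentiable (iter_derive [:: (0, delta_mx j 0)] G) (t, x).
  exact: smF.
have -> : (fun p => jacob p.1 p.2 i j) =
    (fun p => iter_derive [:: (0, delta_mx j 0)] G p i 0).
  by apply/funext => -[t' x']; rewrite mxE.
exact: (continuous_comp (differentiable_continuous dG) (@coord_continuous _ _ _ i 0 _)).
Qed.

Hypothesis oW : open W.

(** Strict differentiability in space, uniform for times near [t]: the Jacobian is jointly
    continuous, and the mean value theorem applies along the segment from [y] to [y'], which stays
    in the ball. *)
Lemma strict_estimate t x e : W t -> x != 0 -> 0 < e ->
  exists2 d, 0 < d & forall t' y y', `|t' - t| < d -> `|y - x| < d -> `|y' - x| < d ->
    `|G (t', y') - G (t', y) - jacob t x *m (y' - y)| <= e * `|y' - y|.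
Proof.
move=> Wt x0 e0; pose e' := e / k.+1%:R; have e'0 : 0 < e' by rewrite divr_gt0.
have nW : \forall p \near (t, x), W p.1.
  exists (W, setT); last by move=> p [].
  by split; [exact: open_nbhs_nbhs|exact: filterT].
have n0 : \forall p \near (t, x), p.2 != 0.
  exists (setT, [set y : 'cV[R]_k | y != 0]); last by move=> p [].
  split; [exact: filterT|apply: open_nbhs_nbhs; split => //].
  have -> : [set y : 'cV[R]_k | y != 0] = ~` [set 0].
    by apply/seteqP; split=> y /= /eqP.
  apply: closed_openC; apply: accessible_closed_set1; apply: hausdorff_accessible.
  exact: norm_hausdorff.
have : \forall p \near (t, x), W p.1 /\ p.2 != 0 /\
    forall i j, `|jacob t x i j - jacob p.1 p.2 i j| < e'.
  near=> p; split; last split.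
  - by near: p; exact: nW.
  - by near: p; exact: n0.
  - near: p; apply: filter_forall => i; apply: filter_forall => j.
    by have /cvgr_dist_lt := @jacob_continuous t x i j Wt x0; apply.
move=> /nbhs_ballP[d /= d0 hd]; exists d => // t' y y' tt' yx y'x.
pose w : 'cV[R]_k := y' - y; pose seg (c : R) : 'cV[R]_k := y + c *: w.
have near_seg (c : R) : 0 <= c <= 1 -> W t' /\ seg c != 0 /\
    forall i j, `|jacob t x i j - jacob t' (seg c) i j| < e'.
  move=> /andP[c0 c1]; apply: (hd (t', seg c)); split => /=.
    by rewrite -ball_normE /= distrC.
  rewrite -ball_normE /= distrC.
  have -> : seg c - x = (1 - c) *: (y - x) + c *: (y' - x).
    by rewrite /seg /w; apply/matrixP => i j; rewrite !mxE; ring.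
  apply: (le_lt_trans (ler_normD _ _)); rewrite !normrZ.
  rewrite (ger0_norm c0) ger0_norm ?subr_ge0//.
  have [->|c0'] := eqVneq c 0; first by rewrite subr0 mul1r mul0r addr0.
  have : c * `|y' - x| < c * d by rewrite ltr_pM2l// lt_def c0'.
  have : (1 - c) * `|y - x| <= (1 - c) * d by rewrite ler_wpM2l ?subr_ge0// ltW.
  by lra.
apply: norm_le_coord => [|i j]; first by rewrite mulr_ge0// ltW.
(* With the linear part subtracted, the derivative along the segment is a difference of two nearby
   Jacobians. *)
rewrite ord1; pose phi (c : R) : R := G (t', seg c) i 0 - c * (jacob t x *m w) i 0.
pose dphi (c : R) : R := ((jacob t' (seg c) - jacob t x) *m w) i 0.
have isd (c : R) : 0 <= c <= 1 -> is_derive c 1 phi (dphi c).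
  move=> /near_seg[Wt' [s0 _]].
  have dG : derivable G (t', seg c) (0, w) by apply: diff_derivable; exact: diffG.
  pose S c' := G (t', seg c').
  have lim_eq : (fun h : R => h^-1 *: ((S \o shift c) (h *: 1) - S c)) =
      (fun h : R => h^-1 *: ((G \o shift (t', seg c)) (h *: (0, w)) - G (t', seg c))).
    apply/funext => h; rewrite /S /comp /shift; congr (_ *: (G _ - _)); congr (_, _).
      by rewrite /= scaler0 add0r.
    by rewrite /seg /= addrCA; congr (_ + _); rewrite -scalerDl /GRing.scale /= mulr1.
  have dS : derivable S c 1 by rewrite /derivable lim_eq.
  have eS : 'D_1 S c = jacob t' (seg c) *m w.
    by rewrite -(jacobE w Wt' s0) /derive lim_eq.
  have dSi : is_derive c 1 (fun c : R => G (t', seg c) i 0) ((jacob t' (seg c) *m w) i 0).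
    apply: DeriveDef; first by have /derivable_mxP := dS; apply.
    by rewrite -eS (derive_mx dS) mxE.
  rewrite /phi /dphi mulmxBl sub_mxE; apply: is_deriveB.
  set a := (jacob t x *m w) i 0.
  have := @is_deriveM _ _ id (cst a) c 1 _ _ (is_derive_id _ _) (is_derive_cst _ _ _).
  by rewrite scaler0 add0r /GRing.scale /= mulr1.
have [c c01 ec] : exists2 c, c \in `[0, 1] & phi 1 - phi 0 = dphi c * (1 - 0).
  apply: MVT_segment => //.
    by move=> c; rewrite in_itv /= => /andP[/ltW ? /ltW ?]; apply: isd; apply/andP.
  by apply: derivable_within_continuous => c; rewrite in_itv /= => /isd[].
rewrite [X in `|X|](_ : _ = phi 1 - phi 0); last first.
  by rewrite /phi /seg scale1r scale0r addr0 mul1r mul0r subr0 /w (addrC y) subrK !sub_mxE addrAC.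
rewrite ec subr0 mulr1 /dphi mxE; apply: (le_trans (ler_norm_sum _ _ _)).
have [_ [_ hj]] := near_seg c c01.
apply: (@le_trans _ _ (k%:R * (e' * `|w|))).
  apply: ler_sum_const => l; rewrite normrM ler_pM ?coord_le_norm//.
  by rewrite ltW// sub_mxE distrC; exact: hj.
rewrite mulrA ler_wpM2r// /e' mulrCA ler_piMr ?(ltW e0)//.
by rewrite ler_pdivrMr// mul1r ler_nat.
Unshelve. all: by end_near. Qed.

End Isotopy.

Section Collapse.
Context {R : realType} {k : nat} (W : set R) (F : R -> 'cV[R]_k -> 'cV[R]_k).
Hypothesis smF : smooth_on [set p : R * 'cV[R]_k | W p.1 /\ p.2 != 0]
                  (fun p : R * 'cV[R]_k => radial (F p.1) p.2).
Hypothesis oW : open W.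
Implicit Types (t : R) (x v w : 'cV[R]_k).

Lemma singular_kernel (A : 'M[R]_k) : \det A = 0 -> exists2 w : 'cV[R]_k, w != 0 & A *m w = 0.
Proof.
rewrite -det_tr => /eqP/det0P[u u0 uA]; exists u^T.
  by apply: contra_neq u0 => e; rewrite -[u]trmxK e trmx0.
by rewrite -[A]trmxK -trmx_mul uA trmx0.
Qed.

(* [jacob F t x] kills the radial direction [x]; adding the rank one term [a *m x^T], with [a]
   normal to the tangent space of the image, makes it invertible. *)
Lemma jacob_completion t x : W t -> sphere k x -> immersion (F t) ->
  exists2 a : 'cV[R]_k, a != 0 /\ a^T *m jacob F t x = 0 &
    jacob F t x + a *m x^T \in unitmx.
Proof.
move=> Wt Sx imm; have x0 := sphere_neq0 Sx; set J := jacob F t x.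
have /det0P[u u0 uJ] : \det J == 0.
  rewrite -det_tr; apply/det0P; exists x^T.
    by apply: contra_neq x0 => e; rewrite -[x]trmxK e trmx0.
  by rewrite -trmx_mul (jacob_radial smF)// trmx0.
exists u^T.
  by rewrite trmxK; split=> //; apply: contra_neq u0 => e; rewrite -[u]trmxK e trmx0.
rewrite unitmxE unitfE; apply/eqP => /singular_kernel[w w0 Bw].
have xw : (x^T *m w) 0 0 = 0.
  have : (u *m u^T) *m (x^T *m w) = 0.
    have := congr1 (mulmx u) Bw.
    by rewrite mulmx0 mulmxDl mulmxDr !mulmxA uJ mul0mx add0r.
  rewrite [u *m _]mx11_scalar mul_scalar_mx => /matrixP/(_ 0 0).
  rewrite [LHS]mxE [RHS]mxE => /eqP; rewrite mulf_eq0 => /orP[|/eqP//].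
  have -> : (u *m u^T) 0 0 = dotp u^T u^T by rewrite dotpE trmxK.
  by move=> /eqP/dotp_eq0 e; rewrite -[u]trmxK e trmx0 eqxx in u0.
have Jw : J *m w = 0.
  move: Bw; rewrite mulmxDl -mulmxA [x^T *m w]mx11_scalar xw.
  by rewrite (_ : 0%:M = 0) ?mulmx0 ?addr0// raddf0.
case/eqP: w0; apply: (imm x) => //; first by rewrite dotpE.
by rewrite derive_slice (jacobE smF).
Qed.

(** Since [y] and [y'] have equal norms, [y + y'] is orthogonal to [y' - y]; hence a chord close to
    [x] is almost tangent at [x]. *)
Lemma sphere_chord x y y' : sphere k y -> sphere k y' ->
  `|dotp x (y' - y)| <= k%:R * (`|y - x| + `|y' - x|) * `|y' - y|.
Proof.
move=> /sphere_dotp Sy /sphere_dotp Sy'.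
have -> : dotp x (y' - y) = - (1 / 2) * dotp ((y - x) + (y' - x)) (y' - y).
  rewrite !(dotpDr, dotpDl, dotpNl, dotpNr) Sy Sy' (dotpC y' y); lra.
rewrite normrM normrN [`|1 / 2|]ger0_norm ?divr_ge0//.
have h : `|dotp (y - x + (y' - x)) (y' - y)| <= k%:R * (`|y - x| + `|y' - x|) * `|y' - y|.
  apply: (le_trans (norm_dotp_le _ _)); rewrite ler_wpM2r// ler_wpM2l//.
  exact: ler_normD.
have := normr_ge0 (dotp (y - x + (y' - x)) (y' - y)).
by move: h; set p := `|dotp _ _|; set q := _ * _ * _ => *; lra.
Qed.

(** Take [a] normal to the image at [x] and [v i] not orthogonal to it. A chord of the image equal
    to [s *: v i] comes from a chord of the sphere of length O(s), so its component along [a] is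
    only a small multiple of [s], whereas that of [s *: v i] is [s] times a fixed nonzero number. *)
Lemma no_collapse t x (I : Type) (v : I -> 'cV[R]_k) :
    W t -> sphere k x -> immersion (F t) ->
    (forall a, a != 0 -> exists i, dotp a (v i) != 0) ->
  exists i, exists2 d, 0 < d & forall t' y y' s,
    `|t' - t| < d -> `|y - x| < d -> `|y' - x| < d -> sphere k y -> sphere k y' -> 0 < s ->
    F t' y' - F t' y <> s *: v i.
Proof.
move=> Wt Sx imm hv; have x0 := sphere_neq0 Sx.
have [a [a0 aJ] uB] := jacob_completion Wt Sx imm.
set J := jacob F t x in aJ uB; pose B := J + a *m x^T; have [i avi] := hv a a0; exists i.
pose b := k%:R * `|invmx B|; have b0 : 0 <= b by rewrite mulr_ge0.
pose ka := k%:R * `|a|; have ka0 : 0 <= ka by rewrite mulr_ge0.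
pose m := `|dotp a (v i)|; have m0 : 0 < m by rewrite normr_gt0.
pose nv := `|v i|; have nv0 : 0 <= nv by exact: normr_ge0.
(* The first bound lets the linearization error be absorbed when the chord is estimated ([hw]); the
   second makes its component along [a] smaller than [s * m]. *)
pose e := Num.min (1 / (4 * (b + 1))) (m / (4 * (b + 1) * (ka + 1) * (nv + 1))).
have b1 : 0 < b + 1 by lra.
have ka1 : 0 < ka + 1 by lra.
have nv1 : 0 < nv + 1 by lra.
have e0 : 0 < e by rewrite lt_min; apply/andP; split; rewrite divr_gt0 ?mulr_gt0 ?ltr0n.
have eb : b * e <= 1 / 4.
  have : e * (b + 1) <= 1 / 4.
    by rewrite -ler_pdivlMr// ge_min !mul1r invfM lexx.
  by have := ltW e0; nra.
have em : ka * (2 * b * nv * e) < m.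
  have : e * (4 * (b + 1) * (ka + 1) * (nv + 1)) <= m.
    by rewrite -ler_pdivlMr ?mulr_gt0// ge_min lexx orbT.
  suff : ka * (2 * b * nv * e) < e * (4 * (b + 1) * (ka + 1) * (nv + 1)) by lra.
  rewrite [ltRHS]mulrC mulrA ltr_pM2r//.
  have : 0 <= b * nv by rewrite mulr_ge0.
  have : 0 <= b * ka by rewrite mulr_ge0.
  have : 0 <= ka * nv by rewrite mulr_ge0.
  have : 0 <= b * nv * ka by rewrite !mulr_ge0.
  by nra.
have [d d0 hd] := strict_estimate smF oW Wt x0 e0.
(* The second radius keeps the rank one term [a *m (x^T *m w)] below [|w| / (4 (b + 1))], by
   [sphere_chord]. *)
exists (Num.min d (1 / (8 * (b + 1) * (ka + 1)))).
  by rewrite lt_min d0 divr_gt0 ?mulr_gt0.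
move=> t' y y' s; rewrite !lt_min => /andP[tt' _] /andP[yx yx'] /andP[y'x y'x'] Sy Sy' s0 eqn.
have := hd t' y y' tt' yx y'x; rewrite /= !radial_sphere// eqn.
set w := y' - y; set r := _ - _ => hr.
have eJ : s *: v i = r + J *m w by rewrite /r subrK.
have hxw : `|a *m (x^T *m w)| <= `|w| / (4 * (b + 1)).
  rewrite [x^T *m w]mx11_scalar mul_mx_scalar normrZ -dotpE.
  have hc := sphere_chord x Sy Sy'; rewrite -/w in hc.
  have d8 : `|y - x| + `|y' - x| <= 1 / (4 * (b + 1) * (ka + 1)).
    have -> : 1 / (4 * (b + 1) * (ka + 1)) = 2 * (1 / (8 * (b + 1) * (ka + 1))).
      by field; rewrite !gt_eqF.
    by move: yx' y'x'; lra.
  have : `|dotp x w| * `|a| <= ka * (`|y - x| + `|y' - x|) * `|w|.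
    rewrite /ka; apply: (le_trans (ler_wpM2r (normr_ge0 a) hc)).
    by rewrite le_eqVlt; apply/orP; left; apply/eqP; ring.
  move=> /le_trans; apply; rewrite mulrC ler_wpM2l//.
  apply: (le_trans (ler_wpM2l ka0 d8)).
  rewrite mul1r [4 * _ * _]mulrC invfM mulrA ler_piMl ?invr_ge0 ?mulr_ge0 ?ltW//.
  by rewrite ltr_pdivrMr// mul1r; lra.
(* Inverting [B] bounds [|w|] by [b * s * nv] plus two errors of at most [|w| / 4] each, whence the
   factor 2. *)
have hw : `|w| <= 2 * b * (s * nv).
  have eB : w = invmx B *m (s *: v i - r + a *m (x^T *m w)).
    by rewrite eJ [r + _]addrC addrK mulmxA -mulmxDl mulmxA mulVmx// mul1mx.
  have : `|w| <= b * (s * nv + e * `|w| + `|w| / (4 * (b + 1))).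
    rewrite {1}eB; apply: (le_trans (norm_mulmx_le _ _)); rewrite -/b ler_wpM2l//.
    apply: (le_trans (ler_normD _ _)); apply: lerD => //.
    apply: (le_trans (ler_normB _ _)); apply: lerD => //.
    by rewrite normrZ gtr0_norm.
  have : b * (`|w| / (4 * (b + 1))) <= `|w| / 4.
    have -> : b * (`|w| / (4 * (b + 1))) = b / (b + 1) * (`|w| / 4) by field; rewrite gt_eqF.
    by rewrite ler_piMl ?divr_ge0// ler_pdivrMr// mul1r; lra.
  have : b * (e * `|w|) <= 1 / 4 * `|w| by rewrite mulrA ler_wpM2r.
  by lra.
(* The normal [a] kills the linear part, so only the remainder [r] is seen by it. *)
have : s * m <= ka * (e * `|w|).
  have -> : s * m = `|dotp a r|.
    rewrite /m -(gtr0_norm s0) -normrM -dotpZr eJ dotpDr [dotp a (J *m w)]dotpE mulmxA aJ.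
    by rewrite mul0mx mxE addr0.
  by apply: (le_trans (norm_dotp_le _ _)); rewrite -/ka ler_wpM2l.
have : ka * (e * `|w|) <= ka * (e * (2 * b * (s * nv))).
  by rewrite ler_wpM2l// ler_wpM2l// ltW.
have -> : ka * (e * (2 * b * (s * nv))) = s * (ka * (2 * b * nv * e)) by ring.
have : s * (ka * (2 * b * nv * e)) < s * m by rewrite ltr_pM2l.
by lra.
Qed.

End Collapse.

Section Packing.
Context {R : realType} {k : nat}.

(* A point of R^(k(k+1)+1): the [k+1] vertices of a simplex and a scale. *)
Definition pdim := #|{: option ('I_k.+1 * 'I_k)}|.
Implicit Types z : 'rV[R]_pdim.

Definition vtx (i : 'I_k.+1) z : 'cV[R]_k := \col_j z 0 (enum_rank (Some (i, j))).
Definition scl z : R := z 0 (enum_rank None).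
Definition pack (Y : 'I_k.+1 -> 'cV[R]_k) (s : R) : 'rV[R]_pdim :=
  \row_l (if enum_val l is Some (i, j) then Y i j 0 else s).

Lemma vtx_pack Y s i : vtx i (pack Y s) = Y i.
Proof. by apply/colP => j; rewrite !mxE enum_rankK. Qed.

Lemma scl_pack Y s : scl (pack Y s) = s.
Proof. by rewrite /scl mxE enum_rankK. Qed.

Lemma pack_inj z z' : (forall i, vtx i z = vtx i z') -> scl z = scl z' -> z = z'.
Proof.
move=> hv hs; apply/rowP => l; rewrite -(enum_valK l).
by case: (enum_val l) => [[i j]|//]; move/colP/(_ j): (hv i); rewrite !mxE.
Qed.

Lemma vtxB i z z' : vtx i (z - z') = vtx i z - vtx i z'.
Proof. by apply/colP => j; rewrite !mxE. Qed.

Lemma sclB z z' : scl (z - z') = scl z - scl z'.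
Proof. by rewrite /scl !mxE. Qed.

Lemma pack_eq0 Y s : pack Y s = 0 -> (forall i, Y i = 0) /\ s = 0.
Proof.
move=> e; split=> [i|]; last by rewrite -(scl_pack Y s) e /scl mxE.
by rewrite -(vtx_pack Y s i) e; apply/colP => j; rewrite !mxE.
Qed.

Lemma vtx_continuous i : continuous (vtx i).
Proof.
apply: mx_continuous => a b.
rewrite (_ : (fun z => vtx i z a b) = fun z => z 0 (enum_rank (Some (i, a)))).
  exact: coord_continuous.
by apply/funext => z; rewrite mxE.
Qed.

Lemma scl_continuous : continuous scl.
Proof. exact: coord_continuous. Qed.

Lemma pack_continuous (T : topologicalType) (Y : T -> 'I_k.+1 -> 'cV[R]_k) (s : T -> R) :
  (forall i, continuous (fun t => Y t i)) -> continuous s ->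
  continuous (fun t => pack (Y t) (s t)).
Proof.
move=> cY cs; apply: mx_continuous => a l; rewrite (_ : (fun t => _) =
    fun t => if enum_val l is Some (i, j) then Y t i j 0 else s t); last first.
  by apply/funext => t; rewrite mxE.
case: (enum_val l) => [[i j] t|]; last exact: cs.
exact: (continuous_comp (cY i t) (@coord_continuous _ _ _ _ _ _)).
Qed.

End Packing.

Lemma sphere_coord (R : realType) (k : nat) (x : 'cV[R]_k) j : sphere k x -> -1 <= x j 0 <= 1.
Proof.
move=> /sphere_dotp Sx; rewrite -ler_norml -(@expr_le1 _ 2)// -normrX ger0_norm ?sqr_ge0//.
rewrite -Sx /dotp (bigD1 j)//= expr2 lerDl sumr_ge0// => i _.
by rewrite -expr2 sqr_ge0.
Qed.

(** * Bounds uniform along the isotopy, by compactness *)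

Section UniformCollapse.
Context {R : realType} {k : nat} (W : set R) (F : R -> 'cV[R]_k -> 'cV[R]_k).
Hypothesis smF : smooth_on [set p : R * 'cV[R]_k | W p.1 /\ p.2 != 0]
                  (fun p : R * 'cV[R]_k => radial (F p.1) p.2).
Hypothesis oW : open W.
Hypothesis W01 : `[0, 1]%classic `<=` W.
Hypothesis embF : forall t : R, 0 <= t <= 1 -> smooth_embedding (F t).
Implicit Types (t : R) (x v w : 'cV[R]_k).

Let G (p : R * 'cV[R]_k) := radial (F p.1) p.2.
(** A compact set containing all times and all vertex tuples on the sphere; the scale coordinate is
    a filler, packed as 0. *)
Let cube : set (R * 'rV[R]_(@pdim k)) :=
  `[0, 1]%classic `*` box (fun=> -1) (fun=> 1).

Let cube_compact : compact cube.
Proof. by apply: compact_setX; [exact: segment_compact|exact: box_compact]. Qed.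

Let cube_pack t (x : 'I_k.+1 -> 'cV[R]_k) :
  0 <= t <= 1 -> (forall i, sphere k (x i)) -> cube (t, pack x 0).
Proof.
move=> t01 Sx; split=> [|l] /=; first by rewrite in_itv.
rewrite mxE; case: (enum_val l) => [[i j]|]; first exact: sphere_coord.
by rewrite lerN10 ler01.
Qed.

Let W_itv t : 0 <= t <= 1 -> W t.
Proof. by move=> t01; apply: W01; rewrite /= in_itv. Qed.

Let vtx_snd_continuous i : continuous (fun p : R * 'rV[R]_(@pdim k) => vtx i p.2).
Proof. by move=> p; apply: (continuous_comp _ (@vtx_continuous _ _ i _)); exact: cvg_snd. Qed.

Let nonsphere_near (p : R * 'rV[R]_(@pdim k)) i :
  ~ sphere k (vtx i p.2) -> \forall q \near p, ~ sphere k (vtx i q.2).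
Proof.
move=> np; have cE : continuous (fun q : R * 'rV[R]_(@pdim k) => enorm (vtx i q.2) - 1).
  move=> q; apply: cvgB; last exact: cvg_cst.
  exact: (continuous_comp (@vtx_snd_continuous i q) (@enorm_continuous _ _ _)).
have : enorm (vtx i p.2) - 1 != 0 by apply/eqP => /eqP; rewrite subr_eq0 => /eqP.
move=> /(cvgr_neq0 _ (cE p)); apply: filterS => q + Sq.
by rewrite Sq subrr eqxx.
Qed.

Let G_vtx_continuous (p : R * 'rV[R]_(@pdim k)) i : W p.1 -> vtx i p.2 != 0 ->
  (fun q : R * 'rV[R]_(@pdim k) => G (q.1, vtx i q.2)) @ p --> G (p.1, vtx i p.2).
Proof.
move=> Wp p0; have cp : continuous (fun q : R * 'rV[R]_(@pdim k) => (q.1, vtx i q.2)).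
  by apply: pair_continuous => // q; exact: cvg_fst.
exact: (continuous_comp (cp p) (isotopy_continuous smF Wp p0)).
Qed.

(** Near a point of [cube] there are three cases. If a vertex is off the sphere, nearby ones are
    too. If some vertex differs from vertex 0, injectivity keeps that edge of the image long. If all
    vertices coincide, [no_collapse] applies. *)
Lemma no_small_inscribed (v : 'I_k -> 'cV[R]_k) :
    (forall a, a != 0 -> exists i, dotp a (v i) != 0) ->
  \forall s \near 0^'+, forall t (x : 'I_k.+1 -> 'cV[R]_k), 0 <= t <= 1 ->
    (forall i, sphere k (x i)) ->
    ~ (forall i, F t (x (lift ord0 i)) - F t (x ord0) = s *: v i).
Proof.
move=> hv; pose P s (p : R * 'rV[R]_(@pdim k)) := 0 <= p.1 <= 1 -> 0 < s ->
  (forall i, sphere k (vtx i p.2)) ->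
  ~ (forall i, F p.1 (vtx (lift ord0 i) p.2) - F p.1 (vtx ord0 p.2) = s *: v i).
suff : \forall s \near 0^'+, cube `<=` P s.
  move=> nP; near=> s; move=> t x t01 Sx.
  have Ps : cube `<=` P s by near: s.
  have := Ps _ (cube_pack t01 Sx) t01.
  have s0 : 0 < s by near: s; exact: nbhs_right_gt.
  move=> /(_ s0) h e; apply: h => [i|i] /=; rewrite !vtx_pack//.
have /compact_near_coveringP := cube_compact; apply => -[t0 z0] [/= + _]; rewrite in_itv /= => t01.
have [Sz|] := pselect (forall i, sphere k (vtx i z0)); last first.
  move=> /existsNP[i /(@nonsphere_near (t0, z0)) nS].
  near=> p s.
  have nSp : ~ sphere k (vtx i p.2) by near: p.
  by move=> _ _ /(_ i).
have Wt := W_itv t01.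
have [/existsP[i xi]|/existsPn eqx] := boolP [exists i, vtx (lift ord0 i) z0 != vtx ord0 z0].
  pose D (p : R * 'rV[R]_(@pdim k)) := G (p.1, vtx (lift ord0 i) p.2) - G (p.1, vtx ord0 p.2).
  have cD : D @ (t0, z0) --> D (t0, z0).
    by apply: cvgB; apply: G_vtx_continuous => //=; exact: sphere_neq0.
  have D0 : 0 < `|D (t0, z0)|.
    rewrite normr_gt0 subr_eq0 /G /= !radial_sphere//.
    have [_ _ [_ [injF _]]] := embF t01.
    by apply: contra_neq xi => /injF; apply; rewrite inE.
  have nD : \forall p \near (t0, z0), `|D (t0, z0)| / 2 < `|D p|.
    by apply: (cvgr_gt _ (cvg_norm cD)); rewrite gtr_pMr// invf_lt1// ltr1n.
  have ns : \forall s \near 0^'+, s < `|D (t0, z0)| / 2 / (`|v i| + 1).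
    by apply: nbhs_right_lt; rewrite !divr_gt0// ltr_wpDl.
  near=> p s.
  have lt1 : `|D (t0, z0)| / 2 < `|D p| by near: p.
  have lt2 : s < `|D (t0, z0)| / 2 / (`|v i| + 1) by near: s.
  move=> /= _ s0 Sp /(_ i) e; move: lt1 lt2.
  rewrite {2}/D /G /= !radial_sphere// e normrZ gtr0_norm// ltr_pdivlMr ?ltr_wpDl//.
  by rewrite mulrDr mulr1 /=; move: s0; lra.
have {}eqx i : vtx i z0 = vtx ord0 z0.
  case: (unliftP ord0 i) => [j ->|-> //].
  by apply/eqP; move: (eqx j); rewrite negbK.
have [_ imm _] := embF t01.
have [i [d d0 hd]] := no_collapse smF oW Wt (Sz ord0) imm hv.
have nv j : \forall p \near (t0, z0), `|vtx j p.2 - vtx ord0 z0| < d.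
  near=> p; rewrite distrC -(eqx j); near: p.
  exact: (cvgr_dist_lt _ _ (@vtx_snd_continuous j (t0, z0))).
have nt : \forall p \near (t0, z0), `|p.1 - t0| < d.
  near=> p; rewrite distrC; near: p.
  apply: (@cvgr_dist_lt _ _ _ _ _ (fun p : R * 'rV[R]_(@pdim k) => p.1) t0) => //.
  exact: cvg_fst.
near=> p s.
have h1 : `|p.1 - t0| < d by near: p.
have h2 : `|vtx ord0 p.2 - vtx ord0 z0| < d by near: p; exact: nv.
have h3 : `|vtx (lift ord0 i) p.2 - vtx ord0 z0| < d by near: p; exact: nv.
by move=> _ s0 Sp /(_ i); exact: hd.
Unshelve. all: by end_near. Qed.

Lemma isotopy_bounded : exists2 M, 0 < M & forall t x, 0 <= t <= 1 -> sphere k x -> `|F t x| <= M.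
Proof.
pose P (M : R) (p : R * 'rV[R]_(@pdim k)) := 0 <= p.1 <= 1 -> sphere k (vtx ord0 p.2) ->
  `|F p.1 (vtx ord0 p.2)| <= M.
have : \forall M \near +oo, cube `<=` P M.
  have /compact_near_coveringP := cube_compact; apply => -[t0 z0] [/= + _].
  rewrite in_itv /= => t01.
  have [Sz|nS] := pselect (sphere k (vtx ord0 z0)); last first.
    near=> p M.
    have nSp : ~ sphere k (vtx ord0 p.2) by near: p; exact: (@nonsphere_near (t0, z0)).
    by [].
  have cG := @G_vtx_continuous (t0, z0) ord0 (W_itv t01) (sphere_neq0 Sz).
  have nG : \forall p \near (t0, z0), `|G (p.1, vtx ord0 p.2)| < `|G (t0, vtx ord0 z0)| + 1.
    by apply: (cvgr_lt _ (cvg_norm cG)); rewrite /= ltrDl.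
  near=> p M.
  have h1 : `|G (p.1, vtx ord0 p.2)| < `|G (t0, vtx ord0 z0)| + 1 by near: p.
  have h2 : `|G (t0, vtx ord0 z0)| + 1 <= M.
    by near: M; apply: nbhs_pinfty_ge; rewrite num_real.
  by move=> _ Sp; rewrite -radial_sphere// (le_trans (ltW h1)).
move=> nP; have /filter_ex[M [M0 hM]] : \forall M \near +oo, 0 < M /\ cube `<=` P M.
  by apply: filterI => //; apply: nbhs_pinfty_gt; rewrite num_real.
exists M => // t x t01 Sx.
have := hM _ (cube_pack (x := fun=> x) t01 (fun=> Sx)) t01; rewrite /= vtx_pack; exact.
Unshelve. all: by end_near. Qed.

Definition clamp t : R := Num.max 0 (Num.min 1 t).

Lemma clamp_itv t : 0 <= clamp t <= 1.
Proof. by rewrite /clamp le_max lexx/= ge_max ler01 ge_min lexx. Qed.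

Lemma clamp_id t : 0 <= t <= 1 -> clamp t = t.
Proof. by case/andP => t0 t1; rewrite /clamp (min_idPr t1) (max_idPr t0). Qed.

Lemma clamp_continuous : continuous clamp.
Proof.
move=> t; apply: continuous_max; first exact: cvg_cst.
by apply: continuous_min; [exact: cvg_cst|exact: cvg_id].
Qed.

(* Extending by homogeneity, and clamping the time, makes the isotopy continuous on all of
   R x R^k; the extension is the identity at time 0. *)
Definition homog t x : 'cV[R]_k := enorm x *: radial (F (clamp t)) x.

Lemma homog_sphere t x : 0 <= t <= 1 -> sphere k x -> homog t x = F t x.
Proof. by move=> t01 Sx; rewrite /homog clamp_id// radial_sphere// Sx scale1r. Qed.

Lemma homog_continuous : continuous (fun p : R * 'cV[R]_k => homog p.1 p.2).
Proof.
have ce : continuous (fun p : R * 'cV[R]_k => enorm p.2).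
  by move=> p; apply: (continuous_comp _ (@enorm_continuous _ _ _)); exact: cvg_snd.
move=> [t x]; have [->|x0] := eqVneq x 0.
  (* At the origin the radial factor has no limit in general, but it is bounded and the factor
     [enorm] tends to 0. *)
  rewrite /continuous_at /homog /= enorm0 scale0r; have [M M0 hM] := isotopy_bounded.
  apply/cvgrPdist_lt => e e0.
  have ne : \forall p \near (t, 0 : 'cV[R]_k), `|0 - enorm p.2| < e / (M + 1).
    have := ce (t, 0); rewrite /continuous_at /= enorm0 => /cvgrPdist_lt; apply.
    by rewrite divr_gt0// ltr_wpDl// ltW.
  near=> p; have : `|0 - enorm p.2| < e / (M + 1) by near: p.
  rewrite !sub0r !normrN (ger0_norm (enorm_ge0 _)) normrZ (ger0_norm (enorm_ge0 _)).
  have [->|p0] := eqVneq p.2 0; first by rewrite enorm0 mul0r.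
  rewrite ltr_pdivlMr ?ltr_wpDl// 1?ltW// => lte.
  apply: le_lt_trans lte; rewrite ler_wpM2l ?enorm_ge0//.
  apply: (@le_trans _ _ M); last by rewrite lerDl.
  by apply: hM; [exact: clamp_itv|exact: sphere_normalize].
apply: cvgZ; first exact: ce.
have cp : continuous (fun p : R * 'cV[R]_k => (clamp p.1, p.2)).
  apply: pair_continuous => p; last exact: cvg_snd.
  by apply: (continuous_comp _ (@clamp_continuous _)); exact: cvg_fst.
exact: (continuous_comp (cp (t, x)) (isotopy_continuous smF (W_itv (clamp_itv t)) x0)).
Unshelve. all: by end_near. Qed.

End UniformCollapse.

(** * Continuation along the isotopy *)

Section Inscribed.
Context {R : realType} {k : nat} (F : R -> 'cV[R]_k -> 'cV[R]_k) (V : 'M[R]_k).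
Hypothesis k0 : (0 < k)%N.
Hypothesis homogF : continuous (fun p : R * 'cV[R]_k => homog F p.1 p.2).
Hypothesis F0 : forall x, sphere k x -> F 0 x = x.
Hypothesis uV : V \in unitmx.
Implicit Types (t s : R) (x y w : 'cV[R]_k) (z : 'rV[R]_(@pdim k)).

Let v (i : 'I_k) : 'cV[R]_k := (row i V)^T.

Let dot_v i x : dotp (v i) x = (V *m x) i 0.
Proof. by rewrite dotpE trmxK -row_mul mxE. Qed.

Let solve (b : 'I_k -> R) : 'cV[R]_k := invmx V *m (\col_i b i).

Let dot_solve b i : dotp (v i) (solve b) = b i.
Proof. by rewrite dot_v mulmxA mulmxV// mul1mx mxE. Qed.

Let dot_v_inj x y : (forall i, dotp (v i) x = dotp (v i) y) -> x = y.
Proof.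
move=> h; have : V *m x = V *m y by apply/colP => i; rewrite -!dot_v.
by move/(congr1 (mulmx (invmx V))); rewrite !mulmxA mulVmx// !mul1mx.
Qed.

Let v_neq0 i : v i != 0.
Proof.
apply/eqP => vi; have := dot_solve (fun=> 1) i.
by rewrite vi dotp0l => /esym/eqP; rewrite oner_eq0.
Qed.

(* The circumsphere of the simplex with vertices [y] and [y + s *: v i] is centred at
   [y + (s / 2) *: c], so for [s = s0] and [y = y0] it is the unit sphere. *)
Let c : 'cV[R]_k := solve (fun i => dotp (v i) (v i)).
Let s0 : R := 2 / enorm c.
Let y0 : 'cV[R]_k := - (s0 / 2) *: c.
Let z0 := pack (fun i => if unlift ord0 i is Some j then y0 + s0 *: v j else y0) s0.

Let c_neq0 : c != 0.
Proof.
apply/eqP => c0; have := dot_solve (fun i => dotp (v i) (v i)) (Ordinal k0).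
by rewrite -/c c0 dotp0r; apply/eqP; rewrite lt_eqF// dotp_gt0.
Qed.

Let s0_gt0 : 0 < s0.
Proof. by rewrite divr_gt0// enorm_gt0. Qed.

Let dot_y0 : dotp y0 y0 = 1.
Proof.
rewrite /y0 dotpZl dotpZr -sqr_enorm /s0; have := enorm_gt0 c_neq0 => e0.
by field; rewrite gt_eqF.
Qed.

(** Since [c] satisfies v_i . c = v_i . v_i, the difference of squared norms is linear in the
    circumcentre; [solve] thus recovers the circumcentre, up to the factor 2 s. *)
Let chord y s i : dotp (y + s *: v i) (y + s *: v i) - dotp y y =
  2 * s * dotp (v i) (y + (s / 2) *: c).
Proof.
rewrite !(dotpDr, dotpDl, dotpZl, dotpZr) dot_solve (dotpC y (v i)); by field.
Qed.

Let assemble (e0 : 'cV[R]_k) (e : 'I_k -> 'cV[R]_k) (r : R) :=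
  pack (fun i => if unlift ord0 i is Some j then e j else e0) r.

Let assemble_eq0 e0 e r : assemble e0 e r = 0 -> [/\ e0 = 0, forall j, e j = 0 & r = 0].
Proof.
move=> /pack_eq0[h r0]; split=> // [|j]; first by have := h ord0; rewrite unlift_none.
by have := h (lift ord0 j); rewrite liftK.
Qed.

Let assemble_continuous (T : topologicalType) (e0 : T -> 'cV[R]_k) (e : 'I_k -> T -> 'cV[R]_k)
    (r : T -> R) : continuous e0 -> (forall j, continuous (e j)) -> continuous r ->
  continuous (fun a => assemble (e0 a) (e^~ a) (r a)).
Proof.
move=> c0 ce cr; apply: pack_continuous => // i; by case: (unliftP ord0 i) => [j _|_]; [exact: ce|].
Qed.

Local Notation Y0 z := (vtx ord0 z).
Local Notation Y j z := (vtx (lift ord0 j) z).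

(** The slot of vertex 0 says that all vertices are equidistant from the origin ([solve] packs these
    k equations into one vector), the other vertex slots prescribe the edges, and the scale slot
    puts vertex 0 on the unit sphere. *)
Let inscription (t : R) z := assemble
  (solve (fun j => dotp (Y j z) (Y j z) - dotp (Y0 z) (Y0 z)))
  (fun j => homog F t (Y j z) - homog F t (Y0 z) - scl z *: v j)
  (dotp (Y0 z) (Y0 z) - 1).

(** Replaces the two quadratic conditions by affine ones, the circumcentre and the scale minus
    [s0]. *)
Let straighten (t : R) z := assemble
  (t *: solve (fun j => dotp (Y j z) (Y j z) - dotp (Y0 z) (Y0 z))
    + (1 - t) *: (Y0 z + (scl z / 2) *: c))
  (fun j => Y j z - Y0 z - scl z *: v j)
  (t * (dotp (Y0 z) (Y0 z) - 1) + (1 - t) * (scl z - s0)).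

(** Triangular at every time: the scale determines vertex 0, and both determine the other
    vertices. *)
Let translate (t : R) z := assemble
  (Y0 z - (t *: (- (scl z / 2) *: c) + (1 - t) *: y0))
  (fun j => Y j z - (t *: (Y0 z + scl z *: v j) + (1 - t) *: (y0 + s0 *: v j)))
  (scl z - s0).

Let translate0 z : translate 0 z = z - z0.
Proof.
apply: pack_inj => [i|]; last by rewrite sclB !scl_pack.
rewrite vtxB !vtx_pack; case: (unliftP ord0 i) => [j ->|->].
  by rewrite scale0r subr0 scale1r add0r.
by rewrite scale0r subr0 scale1r add0r.
Qed.

Let translate1 z : translate 1 z = straighten 0 z.
Proof.
apply: pack_inj => [i|]; last by rewrite !scl_pack mul0r add0r subr0 mul1r.
rewrite !vtx_pack; case: (unliftP ord0 i) => [j _|_].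
  by rewrite subrr scale0r addr0 scale1r opprD addrA.
by rewrite subrr !scale0r addr0 add0r subr0 !scale1r scaleNr opprK.
Qed.

Let homog0 y : homog F 0 y = y.
Proof.
have [->|yn0] := eqVneq y 0; first by rewrite /homog enorm0 scale0r.
rewrite /homog /radial clamp_id ?lexx ?ler01// F0; last exact: sphere_normalize.
by rewrite scalerA mulfV ?scale1r// gt_eqF ?enorm_gt0.
Qed.

Let straighten1 z : straighten 1 z = inscription 0 z.
Proof.
apply: pack_inj => [i|]; last by rewrite !scl_pack mul1r subrr mul0r addr0.
rewrite !vtx_pack; case: (unliftP ord0 i) => [j _|_].
  by rewrite !homog0.
by rewrite scale1r subrr scale0r addr0.
Qed.

Let z0_unique z : scl z = s0 -> Y0 z = y0 -> (forall j, Y j z = y0 + s0 *: v j) -> z = z0.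
Proof.
move=> hs h0 hj; apply: pack_inj => [i|]; last by rewrite scl_pack.
rewrite vtx_pack; case: (unliftP ord0 i) => [j ->|->]; first exact: hj.
by [].
Qed.

Let convex_self t x : t *: x + (1 - t) *: x = x.
Proof. by rewrite -scalerDl addrC subrK scale1r. Qed.

Let translate_zero t z : translate t z = 0 -> z = z0.
Proof.
move=> /assemble_eq0[/eqP h0 hj /eqP]; rewrite subr_eq0 => /eqP hs.
have e : Y0 z = y0.
  by move: h0; rewrite hs -/y0 convex_self subr_eq0 => /eqP.
apply: z0_unique => // j; move: (hj j); rewrite hs e convex_self.
by move/eqP; rewrite subr_eq0 => /eqP.
Qed.

Let mix_neq0 t a : 0 <= t -> t <= 1 -> 0 < a -> t * a + (1 - t) != 0.
Proof.
move=> t0 t1 a0; have ta0 : 0 <= t * a by rewrite mulr_ge0// ltW.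
have [t2|t2] := ltP t 1; first by rewrite gt_eqF//; lra.
have -> : t = 1 by apply/eqP; rewrite eq_le t1.
by rewrite mul1r subrr addr0 gt_eqF.
Qed.

(** Once the edges are prescribed, each interpolation joins a quantity to a positive multiple of
    itself: the factor is 2 s for the circumcentre and (s + s0) / s0^2 for [scl z - s0]. *)
Let straighten_zero t z : 0 <= t <= 1 -> 0 < scl z -> straighten t z = 0 -> z = z0.
Proof.
move=> /andP[t0 t1] sp /assemble_eq0[h0 hj hr].
have {}hj j : Y j z = Y0 z + scl z *: v j.
  by apply/eqP; rewrite -subr_eq0 opprD addrA hj.
have esolve : solve (fun j => dotp (Y j z) (Y j z) - dotp (Y0 z) (Y0 z)) =
    (2 * scl z) *: (Y0 z + (scl z / 2) *: c).
  by apply: dot_v_inj => i; rewrite dot_solve hj chord dotpZr.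
have hc : Y0 z = - (scl z / 2) *: c.
  move: h0; rewrite esolve scalerA -scalerDl => /eqP; rewrite scaler_eq0 => /orP[|].
    by rewrite (negPf (mix_neq0 _ _ _)) ?mulr_gt0.
  by rewrite addr_eq0 scaleNr => /eqP.
have e0 := enorm_gt0 c_neq0.
have hs : scl z = s0.
  have ec : dotp (Y0 z) (Y0 z) - 1 = (scl z + s0) / s0 ^+ 2 * (scl z - s0).
    rewrite hc dotpZl dotpZr -sqr_enorm /s0; field; by rewrite gt_eqF.
  move: hr; rewrite ec mulrA -mulrDl => /eqP; rewrite mulf_eq0 => /orP[|].
    by rewrite (negPf (mix_neq0 _ _ _)) ?divr_gt0 ?addr_gt0 ?exprn_gt0.
  by rewrite subr_eq0 => /eqP.
by apply: z0_unique => // [|j]; rewrite ?hj hc hs.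
Qed.

Let inscription_zero t z : 0 <= t <= 1 -> inscription t z = 0 ->
  (forall i, sphere k (vtx i z)) /\
  (forall j, F t (Y j z) - F t (Y0 z) = scl z *: v j).
Proof.
move=> t01 /assemble_eq0[h0 hj /eqP]; rewrite subr_eq0 => /eqP hy0.
have S i : sphere k (vtx i z).
  apply/sphere_dotp; case: (unliftP ord0 i) => [j ->|->//].
  have := dot_solve (fun j => dotp (Y j z) (Y j z) - dotp (Y0 z) (Y0 z)) j.
  by rewrite h0 dotp0r hy0 => /esym/eqP; rewrite subr_eq0 => /eqP.
split=> // j; apply/eqP; rewrite -subr_eq0.
by rewrite -(homog_sphere F t01 (S ord0)) -(homog_sphere F t01 (S (lift ord0 j))) hj.
Qed.

Let z0_sphere i : sphere k (vtx i z0).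
Proof.
apply/sphere_dotp; rewrite vtx_pack; case: (unliftP ord0 i) => [j _|_]; last exact: dot_y0.
rewrite -[RHS]dot_y0; apply/eqP; rewrite -subr_eq0 chord /y0 -scalerDl addNr scale0r.
by rewrite dotp0r mulr0.
Qed.

Let solve_continuous (T : topologicalType) (b : T -> 'I_k -> R) :
  (forall i, continuous (b^~ i)) -> continuous (fun a => solve (b a)).
Proof.
move=> cb; apply: mx_continuous => i j; rewrite (_ : (fun a => _) =
    fun a => \sum_l invmx V i l * b a l); last first.
  by apply/funext => a; rewrite mxE; apply: eq_bigr => l _; rewrite mxE.
apply: continuous_big => [|l _ a]; first exact: add_continuous.
by apply: cvgM; [exact: cvg_cst|exact: cb].
Qed.

Let cY i : continuous (fun p : R * 'rV[R]_(@pdim k) => vtx i p.2).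
Proof. by move=> p; apply: (continuous_comp _ (@vtx_continuous _ _ i _)); exact: cvg_snd. Qed.

Let cs : continuous (fun p : R * 'rV[R]_(@pdim k) => scl p.2).
Proof. by move=> p; apply: (continuous_comp _ (@scl_continuous _ _ _)); exact: cvg_snd. Qed.

Let cdot i : continuous (fun p : R * 'rV[R]_(@pdim k) => dotp (vtx i p.2) (vtx i p.2)).
Proof. by apply: dotp_continuous; exact: cY. Qed.

Let ct : continuous (fun p : R * 'rV[R]_(@pdim k) => p.1).
Proof. by move=> p; exact: cvg_fst. Qed.

Let ct' : continuous (fun p : R * 'rV[R]_(@pdim k) => 1 - p.1).
Proof. by move=> p; apply: cvgB; [exact: cvg_cst|exact: ct]. Qed.

Let translate_continuous :
  continuous (fun p : R * 'rV[R]_(@pdim k) => translate p.1 p.2).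
Proof.
apply: assemble_continuous => [p|j p|p].
- apply: cvgB; first exact: cY; apply: cvgD; last by apply: cvgZl; exact: ct'.
  apply: cvgZ; first exact: ct; apply: cvgZl; apply: cvgN; apply: cvgMl; exact: cs.
- apply: cvgB; first exact: cY; apply: cvgD; last by apply: cvgZl; exact: ct'.
  apply: cvgZ; first exact: ct; apply: cvgD; first exact: cY.
  by apply: cvgZl; exact: cs.
- by apply: cvgB; [exact: cs|exact: cvg_cst].
Qed.

Let csolve : continuous (fun p : R * 'rV[R]_(@pdim k) =>
  solve (fun j => dotp (Y j p.2) (Y j p.2) - dotp (Y0 p.2) (Y0 p.2))).
Proof. by apply: solve_continuous => i p; apply: cvgB; exact: cdot. Qed.

Let straighten_continuous :
  continuous (fun p : R * 'rV[R]_(@pdim k) => straighten p.1 p.2).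
Proof.
apply: assemble_continuous => [p|j p|p].
- apply: cvgD; apply: cvgZ; [exact: ct|exact: csolve|exact: ct'|].
  apply: cvgD; first exact: cY.
  by apply: cvgZl; apply: cvgMl; exact: cs.
- apply: cvgB; first by apply: cvgB; exact: cY.
  by apply: cvgZl; exact: cs.
- apply: cvgD; apply: cvgM; [exact: ct| |exact: ct'|].
    by apply: cvgB; [exact: cdot|exact: cvg_cst].
  by apply: cvgB; [exact: cs|exact: cvg_cst].
Qed.

Let inscription_continuous :
  continuous (fun p : R * 'rV[R]_(@pdim k) => inscription p.1 p.2).
Proof.
have ch i : continuous (fun p : R * 'rV[R]_(@pdim k) => homog F p.1 (vtx i p.2)).
  move=> p; have cp : continuous (fun q : R * 'rV[R]_(@pdim k) => (q.1, vtx i q.2)).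
    by apply: pair_continuous.
  exact: (continuous_comp (cp p) (@homogF (p.1, vtx i p.2))).
apply: assemble_continuous => [//|j p|p].
- apply: cvgB; first by apply: cvgB; exact: ch.
  by apply: cvgZl; exact: cs.
- by apply: cvgB; [exact: cdot|exact: cvg_cst].
Qed.

Theorem inscribed_homothet (M : R) :
    (forall t x, 0 <= t <= 1 -> sphere k x -> `|F t x| <= M) ->
    (\forall s \near 0^'+, forall t (x : 'I_k.+1 -> 'cV[R]_k), 0 <= t <= 1 ->
      (forall i, sphere k (x i)) ->
      ~ (forall i, F t (x (lift ord0 i)) - F t (x ord0) = s *: v i)) ->
  exists s (x : 'I_k.+1 -> 'cV[R]_k), [/\ 0 < s, forall i, sphere k (x i) &
    forall i, F 1 (x (lift ord0 i)) - F 1 (x ord0) = s *: v i].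
Proof.
move=> hM small; have [eps [eps0 eps_lt heps]] : exists eps : R, [/\ 0 < eps, eps < s0 &
    forall t (x : 'I_k.+1 -> 'cV[R]_k), 0 <= t <= 1 -> (forall i, sphere k (x i)) ->
      ~ (forall i, F t (x (lift ord0 i)) - F t (x ord0) = eps *: v i)].
  apply: (@filter_ex _ (0^'+ : set_system R)); near=> s; split; near: s.
  - exact: nbhs_right_gt.
  - exact: nbhs_right_lt.
  - exact: small.
pose i0 := Ordinal k0; have vi0 : 0 < `|v i0| by rewrite normr_gt0 v_neq0.
have M0 : 0 <= M.
  by apply: le_trans (hM 0 (vtx ord0 z0) _ (z0_sphere _)); rewrite ?normr_ge0// lexx ler01.
(* The edge along [v i0] has length at most 2 M, so a scale above [q] is impossible; [S] exceeds
   both [q] and [s0]. *)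
pose q := 2 * M / `|v i0|; have q0 : 0 <= q by rewrite divr_ge0 ?mulr_ge0 ?normr_ge0.
have qv : q * `|v i0| = 2 * M by rewrite divfK// gt_eqF.
pose S := s0 + q + 1; have s0S : s0 < S by rewrite /S -addrA ltrDl ltr_wpDl.
have hS t (x : 'I_k.+1 -> 'cV[R]_k) : 0 <= t <= 1 -> (forall i, sphere k (x i)) ->
    ~ (forall i, F t (x (lift ord0 i)) - F t (x ord0) = S *: v i).
  move=> t01 Sx /(_ i0) /(congr1 Num.norm).
  rewrite normrZ (gtr0_norm (lt_trans s0_gt0 s0S)) => e.
  have : S * `|v i0| <= M + M by rewrite -e (le_trans (ler_normB _ _))// lerD// hM.
  rewrite /S !mulrDl qv; have : 0 < s0 * `|v i0| by rewrite mulr_gt0.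
  by move: vi0; lra.
(* Vertex coordinates range over [-2, 2], so points of the sphere stay off these faces, and boundary
   solutions can occur only at scale [eps] or [S]. *)
pose lo (l : 'I_(@pdim k)) : R := if enum_val l is Some _ then - 2 else eps.
pose hi (l : 'I_(@pdim k)) : R := if enum_val l is Some _ then 2 else S.
have coordE z i j : z 0 (enum_rank (Some (i, j))) = vtx i z j 0 by rewrite mxE.
have bd z : box_boundary lo hi z -> (forall i, sphere k (vtx i z)) ->
    0 < scl z /\ (scl z = eps \/ scl z = S).
  move=> [bz [l hl]] Sz; split.
    by have := bz (enum_rank None); rewrite /lo enum_rankK => /andP[/(lt_le_trans eps0)].
  move: hl; rewrite /lo /hi -{1 3}(enum_valK l); case: (enum_val l) => [[i j]|//].
  by rewrite coordE => -[] e; have := sphere_coord j (Sz i); rewrite e => /andP[]; lra.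
have scl_gt0 z : box lo hi z -> 0 < scl z.
  move=> /(_ (enum_rank None)); rewrite /lo enum_rankK => /andP[h _].
  exact: lt_le_trans h.
have z0_bd : ~ box_boundary lo hi z0.
  move=> /bd/(_ z0_sphere)[_]; rewrite scl_pack => -[e|e].
    by move: eps_lt; rewrite e ltxx.
  by move: s0S; rewrite -e ltxx.
(* The first two deformations vanish in the box only at [z0], which is interior; along the isotopy
   the boundary is kept free of zeros by [heps] and [hS]. *)
have E0 : essential lo hi (translate 0).
  rewrite (_ : translate 0 = fun z => z - z0); last by apply/funext => z; exact: translate0.
  apply: essential_subr => l; rewrite /lo /hi -{2 3}(enum_valK l).
  case: (enum_val l) => [[i j]|]; last first.
    by rewrite -[z0 _ _]/(scl z0) scl_pack; apply/andP; split; [exact: eps_lt|exact: s0S].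
  by rewrite coordE; have := sphere_coord j (z0_sphere i) => /andP[]; lra.
have E1 : essential lo hi (translate 1).
  apply: essential_homotopy E0 => [|t z t01 bz]; first exact: translate_continuous.
  by apply/eqP => /translate_zero ez; apply: z0_bd; rewrite -ez.
have E2 : essential lo hi (straighten 1).
  apply: (essential_homotopy straighten_continuous).
    move=> t z t01 bz; apply/eqP => /(straighten_zero t01 (scl_gt0 _ bz.1)) ez.
    by apply: z0_bd; rewrite -ez.
  by rewrite (_ : straighten 0 = translate 1)//; apply/funext => z; rewrite translate1.
have E3 : essential lo hi (inscription 1).
  apply: (essential_homotopy inscription_continuous).
    move=> t z t01 bz; apply/eqP => /(inscription_zero t01)[Sz Fz].
    have [_ [e|e]] := bd z bz Sz.
      by apply: (heps t (vtx^~ z)) => // i; rewrite Fz e.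
    by apply: (hS t (vtx^~ z)) => // i; rewrite Fz e.
  by rewrite (_ : inscription 0 = straighten 1)//; apply/funext => z; rewrite straighten1.
have c1 : continuous (inscription 1).
  move=> z; have cp : continuous (fun z : 'rV[R]_(@pdim k) => (1 : R, z)).
    by apply: pair_continuous; [exact: cst_continuous|move=> w; exact: cvg_id].
  exact: (continuous_comp (cp z) (@inscription_continuous (1, z))).
have [//|z bz hz] := E3 _ c1.
have [|Sz Fz] := inscription_zero _ hz; first by rewrite ler01 lexx.
by exists (scl z), (vtx^~ z); split=> //; exact: scl_gt0.
Unshelve. all: by end_near. Qed.

End Inscribed.

(** * Polar decomposition and poses *)

Section Polar.
Context {R : realType} {k : nat}.
Implicit Types (M O P : 'M[R]_k) (u v x y : 'cV[R]_k).

Lemma orthogonal_mxM O P : orthogonal_mx O -> orthogonal_mx P -> orthogonal_mx (O *m P).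
Proof.
by rewrite /orthogonal_mx trmx_mul => hO hP; rewrite -mulmxA (mulmxA _ O) hO mul1mx.
Qed.

Lemma dotp_orthogonal O x y : orthogonal_mx O -> dotp (O *m x) (O *m y) = dotp x y.
Proof. by move=> hO; rewrite dotp_mulmx mulmxA hO mul1mx. Qed.

Lemma enorm_orthogonal O x : orthogonal_mx O -> enorm (O *m x) = enorm x.
Proof. by move=> hO; rewrite /enorm dotp_orthogonal. Qed.

Lemma mxtrace_rank1 P x y : \tr (x *m y^T *m P) = dotp y (P *m x).
Proof. by rewrite -mulmxA mxtrace_mulC -mulmxA trace_mx11 dotpE. Qed.

Definition reflection u : 'M[R]_k := 1%:M - (2 / dotp u u) *: (u *m u^T).

Lemma reflection_orthogonal u : u != 0 -> orthogonal_mx (reflection u).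
Proof.
move=> u0; have uu := dotp_gt0 u0.
have tr : (reflection u)^T = reflection u.
  by rewrite /reflection linearB /= trmx1 linearZ /= trmx_mul trmxK.
rewrite /orthogonal_mx tr /reflection mulmxBr mulmx1 mulmxBl mul1mx.
rewrite -scalemxAl -scalemxAr scalerA.
have -> : u *m u^T *m (u *m u^T) = dotp u u *: (u *m u^T).
  by rewrite -mulmxA (mulmxA _ u) [u^T *m u]mx11_scalar mul_scalar_mx -scalemxAr dotpE.
rewrite scalerA (_ : _ * dotp u u = 2 / dotp u u + 2 / dotp u u); last first.
  by field; rewrite gt_eqF.
by rewrite scalerDl opprB addrK subrK.
Qed.

Lemma mxtrace_reflection P u : \tr (reflection u *m P) = \tr P - 2 / dotp u u * dotp u (P *m u).
Proof.
by rewrite /reflection mulmxBl mul1mx -scalemxAl linearB linearZ /= mxtrace_rank1.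
Qed.

Lemma reflection_mul u x : reflection u *m x = x - (2 / dotp u u * dotp u x) *: u.
Proof.
by rewrite /reflection mulmxBl mul1mx -scalemxAl -mulmxA [u^T *m x]mx11_scalar
  mul_mx_scalar scalerA -dotpE.
Qed.

Lemma quadratic_ge0 (b c : R) : (forall t, 0 <= t * b + t ^+ 2 * c) -> b = 0.
Proof.
(* At [t = - b / d] the form equals b^2 / d^2 (c - d), which is negative unless [b = 0]. *)
move=> h; pose d := `|c| + 1; have d0 : 0 < d by rewrite ltr_wpDl.
have dc : c < d by rewrite (le_lt_trans (ler_norm c))// ltrDl.
have := h (- b / d).
have -> : - b / d * b + (- b / d) ^+ 2 * c = b ^+ 2 / d ^+ 2 * (c - d).
  by field; rewrite gt_eqF.
rewrite nmulr_lge0 ?subr_lt0// pmulr_lle0 ?invr_gt0 ?exprn_gt0// => b0.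
by apply/eqP; rewrite -sqrf_eq0 eq_le b0 sqr_ge0.
Qed.

(* Among all orthogonal [O], the one maximizing the trace of [O *m M] makes [O *m M] symmetric
   and positive: compare it with its products with one and two reflections. *)
Lemma polar_decomposition M :
  exists2 O, orthogonal_mx O & (O *m M)^T = O *m M /\ forall v, 0 <= dotp v (O *m M *m v).
Proof.
pose K : set 'rV[R]_(k * k) := [set u | orthogonal_mx (vec_mx u)].
pose f (u : 'rV[R]_(k * k)) : R := \tr (vec_mx u *m M).
have cvec (i j : 'I_k) : continuous (fun u : 'rV[R]_(k * k) => vec_mx u i j).
  rewrite (_ : (fun u : 'rV[R]_(k * k) => _) = fun u : 'rV[R]_(k * k) => u 0 (mxvec_index i j)).
    exact: coord_continuous.
  by apply/funext => u; rewrite mxE.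
have csum (T : topologicalType) (g : 'I_k -> T -> R) :
    (forall i, continuous (g i)) -> continuous (fun a => \sum_i g i a).
  by move=> cg; apply: continuous_big => // ; exact: add_continuous.
have cmul (T : topologicalType) (g h : T -> R) :
    continuous g -> continuous h -> continuous (fun a => g a * h a).
  by move=> cg ch a; apply: cvgM; [exact: cg|exact: ch].
have cf : continuous f.
  rewrite (_ : f = fun u : 'rV[R]_(k * k) => \sum_i \sum_j vec_mx u i j * M j i); last first.
    by apply/funext => u; apply: eq_bigr => i _; rewrite mxE.
  apply: (@csum _ _) => i; apply: (@csum _ _) => j.
  by apply: (@cmul _ _ (fun=> M j i)); [exact: cvec|exact: cst_continuous].
have Kbox : K `<=` box (fun=> -1) (fun=> 1).
  move=> u Ku l; case/mxvec_indexP: l => i j.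
  rewrite -[u]vec_mxK mxvecE.
  have -> : vec_mx u i j = (col j (vec_mx u)) i 0 by rewrite [RHS]mxE.
  apply: sphere_coord; apply/sphere_dotp.
  have := Ku; rewrite /K /= /orthogonal_mx => /matrixP/(_ j j).
  rewrite [LHS]mxE [RHS]mxE eqxx mulr1n => <-.
  by apply: eq_bigr => l _; rewrite [col _ _ _ _]mxE [_^T _ _]mxE.
have cgram : continuous (fun u : 'rV[R]_(k * k) => (vec_mx u)^T *m vec_mx u).
  apply: mx_continuous => i j; rewrite (_ : (fun u : 'rV[R]_(k * k) => _) =
      fun u : 'rV[R]_(k * k) => \sum_l vec_mx u l i * vec_mx u l j); last first.
    by apply/funext => u; rewrite mxE; apply: eq_bigr => l _; rewrite [_^T _ _]mxE.
  by apply: (@csum _ _) => l; apply: (@cmul _); exact: cvec.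
have cK : compact K.
  apply: (@subclosed_compact _ K (box (fun=> -1) (fun=> 1))) => //; last exact: box_compact.
  rewrite (_ : K = (fun u : 'rV[R]_(k * k) => (vec_mx u)^T *m vec_mx u) @^-1` [set 1%:M])//.
  apply: preimage_closed; first by move=> u _; exact: cgram.
  by apply: accessible_closed_set1; apply: hausdorff_accessible; exact: norm_hausdorff.
have [u Ku max_u] : exists2 u : 'rV[R]_(k * k), u \in K & forall w, w \in K -> f w <= f u.
  apply: EVT_max_rV => //; last exact: continuous_subspaceT.
  by exists (mxvec 1%:M); rewrite /K /= /orthogonal_mx mxvecK trmx1 mul1mx.
have hO : orthogonal_mx (vec_mx u) by move: Ku; rewrite inE.
exists (vec_mx u) => //; set P := _ *m M.
have maxP Q : orthogonal_mx Q -> \tr (Q *m P) <= \tr P.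
  move=> hQ; have := max_u (mxvec (Q *m vec_mx u)); rewrite /f mxvecK mulmxA; apply.
  by rewrite inE /K /= mxvecK; exact: orthogonal_mxM.
have psd v : 0 <= dotp v (P *m v).
  have [->|v0] := eqVneq v 0; first by rewrite dotp0l.
  have := maxP _ (reflection_orthogonal v0); rewrite mxtrace_reflection gerBl.
  by rewrite pmulr_rge0// divr_gt0// dotp_gt0.
split=> //; apply/matrixP => i j; rewrite mxE; apply/eqP.
have [->//|ij] := eqVneq i j; rewrite eq_sym -subr_eq0; apply/eqP.
pose e l : 'cV[R]_k := delta_mx l 0.
have ew a (w : 'cV[R]_k) : dotp (e a) w = w a 0 by rewrite dotpE trmx_delta -rowE mxE.
have ee a b : dotp (e a) (e b) = (a == b)%:R by rewrite ew mxE eqxx andbT.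
have eP a b : dotp (e a) (P *m e b) = P a b by rewrite ew -colE mxE.
apply: (@quadratic_ge0 _ (P i i + P j j)) => t.
(* The product of these two reflections is a rotation in the plane of [e i] and [e j], close to the
   identity for small [t]; the first-order term in [t] is the antisymmetric part of [P]. *)
pose x := e i; pose y := e i + t *: e j.
have xx : dotp x x = 1 by rewrite ee eqxx.
have xy : dotp x y = 1 by rewrite dotpDr dotpZr !ee eqxx (negPf ij) mulr0 addr0.
have yy : dotp y y = 1 + t ^+ 2.
  by rewrite !(dotpDr, dotpDl, dotpZl, dotpZr) !ee !eqxx [j == i]eq_sym (negPf ij) /=; ring.
have yy0 : 0 < 1 + t ^+ 2 by rewrite ltr_pwDl// sqr_ge0.
have x0 : x != 0 by apply/eqP => x0; move: xx; rewrite x0 dotp0r => /esym/eqP; rewrite oner_eq0.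
have y0 : y != 0 by apply/eqP => y0; move: yy0; rewrite -yy y0 dotp0r ltxx.
have := maxP _ (orthogonal_mxM (reflection_orthogonal x0) (reflection_orthogonal y0)).
rewrite -mulmxA !mxtrace_reflection -mulmxA reflection_mul xx yy.
rewrite dotpDr dotpNr dotpZr xy divr1 mulr1.
have -> : dotp x (P *m x) = P i i by exact: eP.
have -> : dotp y (P *m x) = P i i + t * P j i by rewrite dotpDl dotpZl !eP.
have -> : dotp y (P *m y) = P i i + t * P i j + t * (P j i + t * P j j).
  by rewrite mulmxDr -scalemxAr !(dotpDr, dotpDl, dotpZl, dotpZr) !eP; ring.
rewrite -subr_ge0; set w := (X in 0 <= X) => h.
have : 0 <= w * ((1 + t ^+ 2) / 2) by rewrite mulr_ge0// divr_ge0// ltW.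
congr (0 <= _); rewrite /w; field; by rewrite gt_eqF.
Qed.

Lemma positive_definite_unit P : positive_definite P -> P \in unitmx.
Proof.
move=> [_ pd]; rewrite unitmxE unitfE; apply/eqP => /singular_kernel[w w0 Pw].
by have := pd w w0; rewrite Pw dotp0r ltxx.
Qed.

(** With Q M the symmetric positive factor, its square is (Q M)^T (Q M) = M^T M; invertibility of
    [M] makes it definite. *)
Lemma gram_sqrt_exists M : M \in unitmx ->
  exists P, positive_definite P /\ P *m P = M^T *m M.
Proof.
move=> uM; have [Q hQ [sP psd]] := polar_decomposition M.
exists (Q *m M).
split; last by rewrite -{1}sP trmx_mul -mulmxA (mulmxA _ Q) hQ mul1mx.
split=> // v v0; rewrite lt_def psd andbT; apply: contra_neq v0 => vPv.
set P := Q *m M in sP psd vPv.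
(* A null vector of a positive semidefinite form lies in its kernel: the form at [v + t *: (P *m v)]
   has linear coefficient 2 |P v|^2. *)
have Pv : P *m v = 0.
  apply: dotp_eq0; apply: (mulfI (x := 2)); rewrite ?pnatr_eq0// mulr0.
  apply: (@quadratic_ge0 _ (dotp (P *m v) (P *m (P *m v)))) => t.
  have := psd (v + t *: (P *m v)).
  rewrite mulmxDr -scalemxAr !(dotpDr, dotpDl, dotpZl, dotpZr) vPv.
  rewrite [dotp v (P *m (P *m v))]dotp_mulmx sP.
  by congr (0 <= _); ring.
have : M *m v = 0.
  by rewrite -[M]mul1mx -hQ -mulmxA -mulmxA (mulmxA Q) Pv mulmx0.
by move=> /(congr1 (mulmx (invmx M))); rewrite mulmxA mulVmx// mul1mx mulmx0.
Qed.

End Polar.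

(** * Poses of simplices and of their homothetic copies *)

Section Pose.
Context {R : realType} {k : nat}.
Implicit Types (p q : 'I_k.+1 -> 'cV[R]_k) (O U : 'M[R]_k).

(** Otherwise the hyperplane normal to [a] through vertex 0 would contain all k + 1 vertices. *)
Lemma nondegenerate_dotp_eq0 p a : nondegenerate_simplex p ->
  (forall j, dotp a (p (lift ord0 j) - p ord0) = 0) -> a = 0.
Proof.
move=> [_ hp] ha; apply/eqP; apply: contraT => a0.
have := hp a (dotp a (p ord0)) a0; rewrite (_ : [set i | _]%SET = [set: 'I_k.+1]%SET).
  by rewrite cardsT card_ord ltnn.
apply/setP => i; rewrite !inE; case: (unliftP ord0 i) => [j ->|->]; last exact: eqxx.
by rewrite -subr_eq0 -dotpNr -dotpDr ha eqxx.
Qed.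

Lemma enormB_gt0 p i j : configuration p -> i != j -> 0 < enorm (p i - p j).
Proof. by move=> cp ij; rewrite enorm_gt0// subr_eq0; apply: contra_neq ij => /cp. Qed.

Lemma dir_mx_unit p : nondegenerate_simplex p -> dir_mx p \in unitmx.
Proof.
move=> hp; rewrite unitmxE unitfE -det_tr; apply/eqP => /singular_kernel[a a0].
move=> ha; case/eqP: a0; apply: (nondegenerate_dotp_eq0 hp) => j.
have ij : lift ord0 j != ord0 :> 'I_k.+1 by rewrite eq_sym neq_lift.
have e0 := enormB_gt0 hp.1 ij.
have : dotp a (dir p (lift ord0 j) ord0) = 0.
  move/colP/(_ j): ha; rewrite mxE [RHS]mxE => <-; apply: eq_bigr => i _.
  by rewrite !mxE mulrC.
rewrite /dir dotpZr => /eqP; rewrite mulf_eq0 invr_eq0 (gt_eqF e0) => /eqP.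
by [].
Qed.

Lemma gram_sqrtP p : nondegenerate_simplex p ->
  positive_definite (gram_sqrt p) /\ gram_sqrt p *m gram_sqrt p = (dir_mx p)^T *m dir_mx p.
Proof.
move=> /dir_mx_unit/gram_sqrt_exists hP; rewrite /gram_sqrt.
by case: xgetP => [P -> //|/(_ _)/= nP]; case: hP => P /nP.
Qed.

Section HomotheticCopy.
Variables (p q : 'I_k.+1 -> 'cV[R]_k) (O : 'M[R]_k) (s : R).
Hypothesis hO : orthogonal_mx O.
Hypothesis s0 : 0 < s.
Hypothesis hq : forall j, q (lift ord0 j) - q ord0 = s *: (O *m (p (lift ord0 j) - p ord0)).

Let diffE i j : q i - q j = s *: (O *m (p i - p j)).
Proof.
have h i' : q i' - q ord0 = s *: (O *m (p i' - p ord0)).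
  by case: (unliftP ord0 i') => [l ->|->]; [exact: hq|rewrite !subrr mulmx0 scaler0].
have e (r : 'I_k.+1 -> 'cV[R]_k) : r i - r j = (r i - r ord0) - (r j - r ord0).
  by rewrite opprB addrA subrK.
by rewrite e h (h j) -scalerBr -mulmxBr -e.
Qed.

Let enormE i j : enorm (q i - q j) = s * enorm (p i - p j).
Proof. by rewrite diffE enormZ gtr0_norm// enorm_orthogonal. Qed.

Lemma similar_homothetic : configuration p -> similar_simplices p q.
Proof.
move=> cp; split=> [i j qij|i j l _ _ _].
  apply: contrapT => /eqP /(enormB_gt0 cp); rewrite -(pmulr_rgt0 _ s0) -enormE.
  by rewrite qij subrr enorm0 ltxx.
by rewrite /Defs.ratio !enormE invfM mulrACA divff ?mul1r// gt_eqF.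
Qed.

Lemma dir_mx_homothetic : dir_mx q = O *m dir_mx p.
Proof.
have e j : dir q (lift ord0 j) ord0 = O *m dir p (lift ord0 j) ord0.
  by rewrite /dir enormE diffE scalerA invfM mulrAC mulVf ?gt_eqF// mul1r scalemxAr.
apply/matrixP => i j; rewrite [LHS]mxE e !mxE; apply: eq_bigr => l _.
by rewrite [in RHS]mxE.
Qed.

End HomotheticCopy.
End Pose.

Theorem corollary27 (R : realType) (k : nat) (hk : (0 < k)%N)
    (p : 'I_k.+1 -> 'cV[R]_k) (hp : nondegenerate_simplex p) :
  exists Fam : set ('cV[R]_k -> 'cV[R]_k),
    (forall m : nat, Cm_dense m Fam isotopic_to_standard) /\
    (forall gamma : 'cV[R]_k -> 'cV[R]_k, Fam gamma ->
      forall U : 'M[R]_k, orthogonal_mx U ->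
        exists q : 'I_k.+1 -> 'cV[R]_k,
          [/\ similar_simplices p q, inscribed q gamma & pose p q = U]).
Proof.
exists isotopic_to_standard; split=> [m|gamma].
  split=> // f hf e e0; exists f; split=> // s x _ _.
  by rewrite subrr enorm0.
move=> [_ [W [F [oW W01 smF embF F01]]]] U hU.
have [pdP PP] := gram_sqrtP hp; have uM := dir_mx_unit hp.
set P := gram_sqrt p in pdP PP; set M := dir_mx p in PP uM.
have uP := positive_definite_unit pdP; have [sP _] := pdP.
(* The rotation giving pose [U]: the directions of [Q p] form [Q *m M = U *m P], and [Q] is
   orthogonal because [P *m P = M^T *m M]. *)
pose Q := U *m P *m invmx M.
have QM : Q *m M = U *m P by rewrite mulmxKV.
have hQ : orthogonal_mx Q.
  rewrite /orthogonal_mx /Q !trmx_mul sP -!mulmxA (mulmxA U^T) hU mul1mx.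
  by rewrite (mulmxA P) PP -mulmxA mulmxV// mulmx1 -trmx_mul mulmxV// trmx1.
pose V : 'M[R]_k := \matrix_(j, i) (Q *m (p (lift ord0 j) - p ord0)) i 0.
have rowV j : (row j V)^T = Q *m (p (lift ord0 j) - p ord0).
  by apply/colP => i; rewrite !mxE.
have uV : V \in unitmx.
  rewrite unitmxE unitfE; apply/eqP => /singular_kernel[w w0 Vw]; case/eqP: w0.
  have Qw : Q^T *m w = 0.
    apply: (nondegenerate_dotp_eq0 hp) => j; rewrite -dotp_mulmx.
    rewrite dotpC -rowV dotpE trmxK -row_mul Vw.
    by rewrite !mxE.
  have /mulmx1C QQ := hQ.
  by rewrite -[w]mul1mx -QQ -mulmxA Qw mulmx0.
have F0 x : sphere k x -> F 0 x = x by move=> /F01[].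
have [B B0 hB] := isotopy_bounded smF W01.
have small := no_small_inscribed smF oW W01 embF (v := fun j => (row j V)^T).
have [| s [x [s0 Sx hx]]] := inscribed_homothet hk (homog_continuous smF W01) F0 uV hB.
  apply: small => a a0; apply/existsP; apply: contraNT a0 => /existsPn h; apply/eqP.
  suff Va : V *m a = 0 by rewrite -[a]mul1mx -(mulVmx uV) -mulmxA Va mulmx0.
  apply/colP => j; move: (h j); rewrite negbK dotpC dotpE trmxK -row_mul mxE => /eqP ->.
  by rewrite mxE.
pose q i := F 1 (x i).
have hq j : q (lift ord0 j) - q ord0 = s *: (Q *m (p (lift ord0 j) - p ord0)).
  by rewrite /q hx rowV.
exists q; split.
- exact: similar_homothetic hQ s0 hq hp.1.
- by move=> i; exists (x i) => //; have [_ <-] := F01 _ (Sx i).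
(* [U] is a candidate, so the default is not taken; any candidate equals [U] since [P] is
   invertible. *)
- rewrite /pose; case: xgetP => [U' -> [_]|/(_ U)[]]; last first.
    by split=> //; rewrite (dir_mx_homothetic hQ s0 hq).
  rewrite (dir_mx_homothetic hQ s0 hq) -/M QM -/P => /(congr1 (mulmxr (invmx P))).
  by rewrite /= !mulmxK.
Qed.
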